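(* Let $[h,k]\subseteq\mathbb{R}$ be a bounded interval and let $\{f_n\}$ be a bounded sequence of quasicontinuous functions on $[h,k]$ (i.e. there is $M$ with $|f_n(x)|<M$ for all $n$ and all $x$ at which $f_n$ is defined). Assume that $\{f_n(x)\}$ converges to $f(x)$ for a.e. $x\in[h,k]$. Then $f$ is bounded quasicontinuous and $$\lim_{n\to+\infty}\int_h^k f_n(x)\,dx=\int_h^k\Big[\lim_{n\to+\infty}f_n(x)\Big]dx=\int_h^k f(x)\,dx ,$$ where the integrals are Lebesgue integrals in the sense of Tonelli (defined in the context).
   Context: A multiinterval $\Delta=\{(a_n,b_n)\}$ is a finite or countable sequence of open intervals of $\mathbb{R}$ (not necessarily disjoint); $\mathcal{I}_\Delta=\bigcup_n(a_n,b_n)$ and $L(\Delta)=\sum_n(b_n-a_n)\in(0,+\infty]$. A set $N\subseteq\mathbb{R}$ is a null set if for every $\varepsilon>0$ there is a multiinterval $\Delta$ with $L(\Delta)<\varepsilon$ and $N\subseteq\mathcal{I}_\Delta$. A property holds a.e. if it fails only on a null set. A real function $f$ defined a.e. on an interval $R$ is quasicontinuous on $R$ if for every $\varepsilon>0$ there is a multiinterval $\Delta_\varepsilon$ with $L(\Delta_\varepsilon)<\varepsilon$ such that $f$ is defined on $R\setminus\mathcal{I}_{\Delta_\varepsilon}$ and the restriction $f_{|R\setminus\mathcal{I}_{\Delta_\varepsilon}}$ is continuous. It is bounded quasicontinuous if moreover it is bounded. Lebesgue integral (Tonelli): let $f$ be bounded quasicontinuous on the bounded closed interval $R=[h,k]$.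 Choose for each $n$ a multiinterval $\Delta_n$ with $L(\Delta_n)<1/n$ such that $f_{|R\setminus\mathcal{I}_{\Delta_n}}$ is continuous, and let $\phi_n$ be a continuous extension of $f_{|R\setminus\mathcal{I}_{\Delta_n}}$ to $R$ having the same infimum and supremum as $f_{|R\setminus\mathcal{I}_{\Delta_n}}$. Then $\int_h^k f(x)\,dx:=\lim_{n\to\infty}\int_h^k\phi_n(x)\,dx$, the integrals on the right being Riemann integrals (the limit exists and does not depend on the choices).
   Formalization: It is assumed that h < k and that, wherever f is defined on [h,k], all f_n are defined and converge to f(x); with arbitrary values of f on the exceptional null set f need not be bounded (f_n = 0, f(1/m) = m, f = 0 elsewhere). *)

(* Defs.v *)
(* World: Stdlib reals with Coquelicot. *)
From Stdlib Require Import Reals Lra.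
From Coquelicot Require Import Coquelicot.
Open Scope R_scope.

(* [last = None]: infinite sequence; [last = Some m]: the indices 0, ..., m. *)
Definition index_in (last : option nat) (n : nat) : bool :=
  match last with
  | None => true
  | Some m => Nat.leb n m
  end.

(* The endpoints at indices outside the range given by [mi_last] are junk. *)
Record multiinterval := Multiinterval {
  mi_last : option nat;
  mi_left : nat -> R;
  mi_right : nat -> R;
  mi_lt : forall n, index_in mi_last n = true -> mi_left n < mi_right n
}.

Definition mi_union (D : multiinterval) (x : R) : Prop :=
  exists n, index_in (mi_last D) n = true /\ mi_left D n < x < mi_right D n.

Definition mi_term (D : multiinterval) (n : nat) : R :=
  if index_in (mi_last D) n then mi_right D n - mi_left D n else 0.

(* The partial sums are nondecreasing, so this is their limit in (0, +oo]. *)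
Definition mi_length (D : multiinterval) : Rbar :=
  Lim_seq (fun n => sum_n (mi_term D) n).

Definition null_set (N : R -> Prop) : Prop :=
  forall eps : R, 0 < eps ->
  exists D : multiinterval,
    Rbar_lt (mi_length D) eps /\ forall x, N x -> mi_union D x.

Definition ae_on (I P : R -> Prop) : Prop :=
  null_set (fun x => I x /\ ~ P x).

(* The values of [pval] outside [pdom] are junk. *)
Record pfun := Pfun {
  pdom : R -> Prop;
  pval :> R -> R
}.

Definition set_off (I : R -> Prop) (D : multiinterval) (x : R) : Prop :=
  I x /\ ~ mi_union D x.

Definition continuous_off (f : pfun) (I : R -> Prop) (D : multiinterval) :
    Prop :=
  (forall x, set_off I D x -> pdom f x) /\ continuous_on (set_off I D) f.

Definition quasicontinuous (f : pfun) (I : R -> Prop) : Prop :=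
  ae_on I (pdom f) /\
  forall eps : R, 0 < eps ->
  exists D : multiinterval,
    Rbar_lt (mi_length D) eps /\ continuous_off f I D.

Definition bounded_quasicontinuous (f : pfun) (I : R -> Prop) : Prop :=
  quasicontinuous f I /\
  exists M : R, forall x, I x -> pdom f x -> Rabs (f x) <= M.

Definition segment (h k : R) (x : R) : Prop := h <= x <= k.

Definition image (g : R -> R) (A : R -> Prop) (y : R) : Prop :=
  exists x, A x /\ y = g x.

(* [phi] is only relevant on the interval [I]. *)
Definition admissible_extension (f : pfun) (I : R -> Prop)
    (D : multiinterval) (phi : R -> R) : Prop :=
  continuous_on I phi /\
  (forall x, set_off I D x -> phi x = f x) /\
  Glb_Rbar (image phi I) = Glb_Rbar (image f (set_off I D)) /\
  Lub_Rbar (image phi I) = Lub_Rbar (image f (set_off I D)).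

(* Sequences start at index 0, whence 1 / (n + 1) in place of 1 / n. *)
Definition admissible_choice (f : pfun) (h k : R)
    (D : nat -> multiinterval) (phi : nat -> R -> R) : Prop :=
  forall n : nat,
    Rbar_lt (mi_length (D n)) (1 / (INR n + 1)) /\
    continuous_off f (segment h k) (D n) /\
    admissible_extension f (segment h k) (D n) (phi n).

(* The last two clauses say that the limit of the Riemann integrals is [l]
   whatever the choices, and that choices exist, so that [l] is unique. *)
Definition is_tonelli_int (f : pfun) (h k l : R) : Prop :=
  bounded_quasicontinuous f (segment h k) /\
  (exists D phi, admissible_choice f h k D phi) /\
  (forall D phi, admissible_choice f h k D phi ->
     is_lim_seq (fun n => RInt (phi n) h k) l).

Definition ex_tonelli_int (f : pfun) (h k : R) : Prop :=
  exists l : R, is_tonelli_int f h k l.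

Definition tonelli_int (f : pfun) (h k : R) : R :=
  iota (is_tonelli_int f h k).

Lemma is_tonelli_int_unique (f : pfun) (h k l : R) :
  is_tonelli_int f h k l -> tonelli_int f h k = l.
Proof.
intros Hl.
apply (iota_unique (V := R_CompleteNormedModule)); [|exact Hl].
intros l' (_ & _ & Hl').
destruct Hl as (_ & (D & phi & Hc) & Hl).
generalize (is_lim_seq_unique _ _ (Hl' D phi Hc)).
rewrite (is_lim_seq_unique _ _ (Hl D phi Hc)).
intros E; injection E; auto.
Qed.

Definition converges_at (fs : nat -> pfun) (f : pfun) (x : R) : Prop :=
  (forall n, pdom (fs n) x) /\ pdom f x /\
  is_lim_seq (fun n => fs n x) (f x).

Definition lim_pfun (fs : nat -> pfun) : pfun :=
  Pfun (fun x => (forall n, pdom (fs n) x) /\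
                 ex_finite_lim_seq (fun n => fs n x))
       (fun x => real (Lim_seq (fun n => fs n x))).

(* Main.v *)
Require Import Defs.
From Stdlib Require Import Reals Lra Lia List Cantor FinFun.
From Stdlib Require Import IndefiniteDescription Classical.
From Coquelicot Require Import Coquelicot.
Open Scope R_scope.

(** Everything rests on one estimate and on one covering theorem.

    The estimate ([abs_RInt_le_off]): if [g] is continuous on [[h,k]] with
    [|g| <= C], and [|g| <= eta] outside a set of outer measure at most [c],
    then the Riemann integral of [g] is at most [eta * (k - h) + C * c] in
    absolute value.  Two continuous functions close to the same [f] off
    multiintervals of small length therefore have close integrals.  Together
    with an extension theorem for continuous functions on closed sets, this
    makes the Tonelli integral of a bounded quasicontinuous function exist
    ([ex_tonelli_int_bounded]), and shows that the integral of any bounded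
    continuous function that is close to [f] off a small set is close to the
    Tonelli integral of [f] ([tonelli_int_close]).

    The covering theorem is that of Egorov ([egorov_quasicontinuous]): off a
    multiinterval of arbitrarily small length all the [fs n] are continuous and
    converge uniformly to [f].  Hence [f] is continuous there, so it is
    quasicontinuous; and a continuous extension [phi] of [f] from the complement
    of that multiinterval is close, off it, both to [f] and to [fs n] for large
    [n], so that both Tonelli integrals are close to the Riemann integral of
    [phi].  This is [bounded_convergence].  It applies both to [f] and to
    [lim_pfun fs], whence the equality of their integrals.

    Egorov's theorem is reduced, by extending the [fs n], to functions [phi n]
    continuous on the whole segment that converge off a small set, and there it
    is proved without measurable sets.  For fixed [j], the maximal deviations
    of [phi j], ..., [phi (j + N - 1)] from [phi j] form a sequence of
    continuous functions increasing in [N] with bounded integrals; by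
    Chebyshev's inequality it is, up to a small tolerance and off a small set,
    bounded by one of its terms, say the one of index [N0 j]
    ([almost_uniform_of_monotone]).  Off the union of these small sets,
    convergence at a point says that one of the continuous deviations of index
    [N0 j] is small near that point, and compactness of the segment bounds the
    [j] needed.

    All compactness arguments, including those in the integral estimate and in
    Chebyshev's inequality, are instances of one continuous induction principle
    ([cousin]), so that no step function is ever integrated. *)

(** * Continuous induction and continuity in terms of distances *)

(** The supremum of the [t] with [Q h t] can be neither unreached nor less than
    [k].  With [Q s t] an assertion about a finite subcover of [[s,t]] this is
    the Heine-Borel theorem, but [Q] may also carry an estimate that is additive
    in the segment. *)
Lemma cousin (Q : R -> R -> Prop) (h k : R) :
  h <= k ->
  (forall s m t, h <= s <= m -> m <= t <= k -> Q s m -> Q m t -> Q s t) ->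
  (forall x, h <= x <= k -> exists d, 0 < d /\ forall s t,
     h <= s <= x -> x <= t <= k -> x - d < s -> t < x + d -> Q s t) ->
  Q h k.
Proof.
intros hk Hadd Hloc.
set (E := fun t => h <= t <= k /\ Q h t).
assert (Eh : E h).
{ split; [lra|]. destruct (Hloc h) as (d & Hd & H); [lra|]. apply H; lra. }
destruct (completeness E) as (c & Hub & Hlub).
{ exists k. intros t [Ht _]. lra. }
{ exists h. exact Eh. }
assert (Hc : h <= c <= k).
{ split; [apply Hub, Eh|]. apply Hlub. intros t [Ht _]. lra. }
destruct (Hloc c Hc) as (d & Hd & H).
assert (Qc : Q h c).
{ destruct (classic (exists t, E t /\ c - d < t)) as [(t & [Ht Qt] & Htc)|Hn].
  - assert (t <= c) by (apply Hub; split; assumption).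
    apply (Hadd h t c); try lra; [assumption|]. apply H; lra.
  - exfalso. assert (c <= c - d); [|lra].
    apply Hlub. intros t Et. apply Rnot_lt_le. intros Hlt. apply Hn.
    now exists t. }
destruct (Rle_lt_dec k c) as [Hkc|Hck].
{ replace k with c by lra. exact Qc. }
set (t := Rmin k (c + d / 2)).
assert (Ht : c < t <= k /\ t < c + d).
{ unfold t, Rmin. destruct Rle_dec; lra. }
exfalso. assert (t <= c); [|lra].
apply Hub. split; [lra|]. apply (Hadd h c t); try lra; [exact Qc|].
apply H; lra.
Qed.

Lemma continuous_on_iff (D : R -> Prop) (f : R -> R) :
  continuous_on D f <->
  forall x, D x -> forall eps, 0 < eps -> exists d, 0 < d /\
    forall y, D y -> Rabs (y - x) < d -> Rabs (f y - f x) < eps.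
Proof.
split.
- intros H x Dx eps Heps.
  destruct (proj1 (filterlim_locally _ _) (H x Dx) (mkposreal eps Heps))
    as (d & Hd).
  exists d. split; [apply cond_pos|]. intros y Dy Hy. exact (Hd y Hy Dy).
- intros H x Dx. apply filterlim_locally. intros eps.
  destruct (H x Dx eps (cond_pos eps)) as (d & Hd & H').
  exists (mkposreal d Hd). intros y Hy Dy. exact (H' y Dy Hy).
Qed.

Lemma continuous_iff (f : R -> R) (x : R) :
  continuous f x <->
  forall eps, 0 < eps -> exists d, 0 < d /\
    forall y, Rabs (y - x) < d -> Rabs (f y - f x) < eps.
Proof.
split.
- intros H eps Heps.
  destruct (proj1 (filterlim_locally _ _) H (mkposreal eps Heps)) as (d & Hd).
  exists d. split; [apply cond_pos|]. exact Hd.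
- intros H. apply filterlim_locally. intros eps.
  destruct (H eps (cond_pos eps)) as (d & Hd & H').
  now exists (mkposreal d Hd).
Qed.

Definition clamp (a b x : R) : R := Rmax a (Rmin b x).

Lemma clamp_in (a b x : R) : a <= b -> a <= clamp a b x <= b.
Proof.
intros. unfold clamp, Rmax, Rmin. repeat destruct Rle_dec; lra.
Qed.

Lemma clamp_id (a b x : R) : a <= x <= b -> clamp a b x = x.
Proof.
intros. unfold clamp, Rmax, Rmin. repeat destruct Rle_dec; lra.
Qed.

Lemma clamp_incr (a b x y : R) : x <= y -> clamp a b x <= clamp a b y.
Proof.
intros. unfold clamp, Rmax, Rmin. repeat destruct Rle_dec; lra.
Qed.

Lemma clamp_lipschitz (a b x y : R) :
  Rabs (clamp a b x - clamp a b y) <= Rabs (x - y).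
Proof.
unfold clamp, Rmax, Rmin, Rabs.
repeat destruct Rle_dec; repeat destruct Rcase_abs; lra.
Qed.

(** Admissible extensions are only continuous relative to the segment; composed
    with [clamp h k] they become subject to the estimates for functions
    continuous on the line. *)
Lemma continuous_clamp (h k : R) (f : R -> R) :
  h <= k -> continuous_on (segment h k) f ->
  forall x, continuous (fun x => f (clamp h k x)) x.
Proof.
intros hk Hf x. apply continuous_iff. intros eps Heps.
destruct (proj1 (continuous_on_iff _ _) Hf (clamp h k x)
  (clamp_in h k x hk) eps Heps) as (d & Hd & H).
exists d. split; [exact Hd|]. intros y Hy. apply H; [now apply clamp_in|].
apply Rle_lt_trans with (2 := Hy). apply clamp_lipschitz.
Qed.

Lemma continuous_on_of_continuous (D : R -> Prop) (f : R -> R) :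
  (forall x, continuous f x) -> continuous_on D f.
Proof.
intros H. apply continuous_on_iff. intros x _ eps Heps.
destruct (proj1 (continuous_iff f x) (H x) eps Heps) as (d & Hd & H').
exists d. auto.
Qed.

Lemma ex_RInt_cont (f : R -> R) (a b : R) :
  (forall x, continuous f x) -> ex_RInt f a b.
Proof.
intros H. apply (ex_RInt_continuous (V := R_CompleteNormedModule)). auto.
Qed.

(** * Outer measure *)

Lemma mi_term_nonneg (D : multiinterval) (n : nat) : 0 <= mi_term D n.
Proof.
unfold mi_term. destruct (index_in (mi_last D) n) eqn:E; [|lra].
generalize (mi_lt D n E). lra.
Qed.

Lemma sum_n_incr (u : nat -> R) :
  (forall n, 0 <= u n) -> forall n, sum_n u n <= sum_n u (S n).
Proof.
intros H n. rewrite sum_Sn. unfold plus; simpl. generalize (H (S n)). lra.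
Qed.

Lemma mi_length_lt_inv (D : multiinterval) (e : R) :
  Rbar_lt (mi_length D) e ->
  exists c, c < e /\ forall N, sum_n (mi_term D) N <= c.
Proof.
intros H.
assert (Hl : is_lim_seq (fun n => sum_n (mi_term D) n) (mi_length D)).
{ apply Lim_seq_correct, ex_lim_seq_incr, sum_n_incr, mi_term_nonneg. }
destruct (mi_length D) as [l| |]; simpl in H; [|easy|].
- exists l. split; [exact H|].
  exact (is_lim_seq_incr_compare _ _ Hl
           (sum_n_incr _ (mi_term_nonneg D))).
- exfalso. destruct (proj2 (is_lim_seq_spec _ _) Hl (mi_term D 0)) as (N & HN).
  specialize (HN N (le_n N)).
  assert (mi_term D 0 <= sum_n (mi_term D) N); [|lra].
  clear HN. induction N as [|N IH]; [rewrite sum_O; lra|].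
  generalize (sum_n_incr _ (mi_term_nonneg D) N). lra.
Qed.

Lemma mi_length_le (D : multiinterval) (c : R) :
  (forall N, sum_n (mi_term D) N <= c) -> Rbar_le (mi_length D) c.
Proof.
intros H.
apply (is_lim_seq_le _ (fun _ => c) _ _ H); [|apply is_lim_seq_const].
apply Lim_seq_correct, ex_lim_seq_incr, sum_n_incr, mi_term_nonneg.
Qed.

(** The Lebesgue outer measure of [A] is at most [c].  The margin [eps] makes
    the relation stable under countable unions, and lets it hold with [c = 0]
    although every multiinterval has positive length. *)
Definition outer_le (A : R -> Prop) (c : R) : Prop :=
  forall eps, 0 < eps -> exists D, Rbar_lt (mi_length D) (c + eps) /\
    forall x, A x -> mi_union D x.

Lemma outer_le_mono (A B : R -> Prop) (c d : R) :
  (forall x, A x -> B x) -> c <= d -> outer_le B c -> outer_le A d.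
Proof.
intros HAB Hcd HB eps Heps. destruct (HB eps Heps) as (D & HD & HBD).
exists D. split; [|auto]. apply Rbar_lt_le_trans with (1 := HD). simpl. lra.
Qed.

Lemma outer_le_nonneg (A : R -> Prop) (c : R) : outer_le A c -> 0 <= c.
Proof.
intros H. apply Rnot_lt_le. intros Hc.
destruct (H (- c)) as (D & HD & _); [lra|].
destruct (mi_length_lt_inv D _ HD) as (c' & Hc' & HN).
specialize (HN 0%nat). rewrite sum_O in HN.
generalize (mi_term_nonneg D 0). lra.
Qed.

Lemma outer_le_union_of (D : multiinterval) (c : R) :
  Rbar_lt (mi_length D) c -> outer_le (mi_union D) c.
Proof.
intros H eps Heps. exists D. split; [|auto].
apply Rbar_lt_trans with (1 := H). simpl. lra.
Qed.

Lemma outer_le_segment (s t : R) : s <= t -> outer_le (segment s t) (t - s).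
Proof.
intros Hst eps Heps.
assert (Hlt : forall n, index_in (Some 0%nat) n = true ->
                s - eps / 4 < t + eps / 4) by (intros; lra).
exists (Multiinterval (Some 0%nat) (fun _ => s - eps / 4)
          (fun _ => t + eps / 4) Hlt).
split.
- apply Rbar_le_lt_trans with (t - s + eps / 2); [|simpl; lra].
  apply mi_length_le. intros N. induction N as [|N IH].
  + rewrite sum_O. unfold mi_term. simpl. lra.
  + rewrite sum_Sn. unfold plus. simpl.
    unfold mi_term at 2. simpl. lra.
- intros x Hx. exists 0%nat. simpl. unfold segment in Hx. split; [easy|lra].
Qed.

Lemma outer_le_empty (A : R -> Prop) : (forall x, ~ A x) -> outer_le A 0.
Proof.
intros H. apply outer_le_mono with (segment 0 0) (0 - 0); [|lra|].
- intros x Hx. now destruct (H x).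
- apply outer_le_segment. lra.
Qed.

Lemma sum_n_halves (e : R) (N : nat) :
  sum_n (fun i => e * (/ 2) ^ S i) N = e * (1 - (/ 2) ^ S N).
Proof.
induction N as [|N IH].
- rewrite sum_O. simpl. lra.
- rewrite sum_Sn, IH. unfold plus; simpl. lra.
Qed.

Lemma sum_n_halves_le (e : R) (N : nat) :
  0 <= e -> sum_n (fun i => e * (/ 2) ^ S i) N <= e.
Proof.
intros He. rewrite sum_n_halves.
assert (0 < (/ 2) ^ S N) by (apply pow_lt; lra). nra.
Qed.

Definition list_sum {T : Type} (t : T -> R) (l : list T) : R :=
  fold_right (fun p r => t p + r) 0 l.

Lemma list_sum_app {T : Type} (t : T -> R) (l m : list T) :
  list_sum t (l ++ m) = list_sum t l + list_sum t m.
Proof. induction l as [|x l IH]; simpl; [lra|]. rewrite IH. lra. Qed.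

Lemma list_sum_map {S T : Type} (f : S -> T) (t : T -> R) (l : list S) :
  list_sum t (map f l) = list_sum (fun x => t (f x)) l.
Proof. induction l as [|x l IH]; simpl; [lra|]. rewrite IH. lra. Qed.

Lemma list_sum_le {T : Type} (t u : T -> R) (l : list T) :
  (forall p, t p <= u p) -> list_sum t l <= list_sum u l.
Proof.
intros H. induction l as [|x l IH]; simpl; [lra|]. generalize (H x). lra.
Qed.

(** Lists without repetition stand for finite sets of indices, so that sums of
    nonnegative terms in different orders can be compared. *)
Lemma list_sum_incl {T : Type} (t : T -> R) (l m : list T) :
  (forall p, 0 <= t p) -> NoDup l -> incl l m -> list_sum t l <= list_sum t m.
Proof.
intros Ht Hl. revert m. induction Hl as [|x l Hx Hl IH]; intros m Hm; simpl.
- clear Hm. induction m as [|y m IHm]; simpl; [lra|]. generalize (Ht y). lra.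
- destruct (in_split x m) as (m1 & m2 & ->); [apply Hm; now left|].
  assert (list_sum t l <= list_sum t (m1 ++ m2)) as H.
  { apply IH. intros y Hy. assert (In y (m1 ++ x :: m2)) by (apply Hm; now right).
    rewrite in_app_iff in *. simpl in *.
    destruct H as [H|[->|H]]; auto. now destruct Hx. }
  rewrite list_sum_app in *. simpl. lra.
Qed.

Lemma sum_n_list_sum (u : nat -> R) (N : nat) :
  sum_n u N = list_sum u (seq 0 (S N)).
Proof.
induction N as [|N IH].
- rewrite sum_O. simpl. lra.
- rewrite sum_Sn, IH, (seq_S (S N)), list_sum_app. unfold plus; simpl. lra.
Qed.

Lemma list_sum_prod {S T : Type} (t : S * T -> R) (l : list S) (m : list T) :
  list_sum t (list_prod l m) = list_sum (fun x => list_sum (fun y => t (x, y)) m) l.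
Proof.
induction l as [|x l IH]; simpl; [easy|].
now rewrite list_sum_app, list_sum_map, IH.
Qed.

(** The indices below [N] in Cantor's enumeration of the pairs all lie in the
    square of side [N], since neither coordinate exceeds the code. *)
Lemma sum_n_of_nat_le (t : nat * nat -> R) (c : nat -> R) (C : R) :
  (forall p, 0 <= t p) ->
  (forall i J, sum_n (fun j => t (i, j)) J <= c i) ->
  (forall I, sum_n c I <= C) ->
  forall N, sum_n (fun n => t (Cantor.of_nat n)) N <= C.
Proof.
intros Ht Hc HC N.
rewrite sum_n_list_sum, <- list_sum_map.
apply Rle_trans with
  (list_sum t (list_prod (seq 0 (S N)) (seq 0 (S N)))).
- apply list_sum_incl; [exact Ht| |].
  + apply FinFun.Injective_map_NoDup; [|apply seq_NoDup].
    intros x y E. now rewrite <- (cancel_to_of x), E, cancel_to_of.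
  + intros [i j] Hij. apply in_map_iff in Hij. destruct Hij as (n & E & Hn).
    apply in_seq in Hn. assert (Hle := to_nat_non_decreasing i j).
    rewrite <- E, cancel_to_of in Hle.
    apply in_prod; apply in_seq; lia.
- rewrite list_sum_prod. apply Rle_trans with (sum_n c N); [|apply HC].
  rewrite sum_n_list_sum. apply list_sum_le. intros i.
  rewrite <- sum_n_list_sum. apply Hc.
Qed.

(** The covers [D i] are merged along Cantor's enumeration of the pairs.  A [D i]
    may be finite, whereas the merged family is infinite: the missing
    intervals are replaced by intervals of length [e n], which adds
    at most [eps / 4]. *)
Lemma outer_le_countable_union (A : nat -> R -> Prop) (c : nat -> R) (C : R) :
  (forall i, outer_le (A i) (c i)) -> (forall N, sum_n c N <= C) ->
  outer_le (fun x => exists i, A i x) C.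
Proof.
intros HA HC eps Heps.
set (e := fun n => eps / 4 * (/ 2) ^ S n).
assert (He : forall n, 0 < e n).
{ intros n. apply Rmult_lt_0_compat; [lra|]. apply pow_lt. lra. }
destruct (functional_choice (fun i D => Rbar_lt (mi_length D) (c i + e i) /\
    forall x, A i x -> mi_union D x)) as (D & HD).
{ intros i. apply HA, He. }
set (ok := fun n => let (i, j) := Cantor.of_nat n in
              index_in (mi_last (D i)) j).
set (lft := fun n => let (i, j) := Cantor.of_nat n in
              if ok n then mi_left (D i) j else 0).
set (rgt := fun n => let (i, j) := Cantor.of_nat n in
              if ok n then mi_right (D i) j else e n).
assert (Hlt : forall n, index_in None n = true -> lft n < rgt n).
{ intros n _. unfold lft, rgt. destruct (of_nat n) as (i, j) eqn:E.
  destruct (ok n) eqn:Eok; [|apply He].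
  unfold ok in Eok. rewrite E in Eok. now apply mi_lt. }
exists (Multiinterval None lft rgt Hlt). split.
- apply Rbar_le_lt_trans with (C + eps / 4 + eps / 4); [|simpl; lra].
  apply mi_length_le. intros N.
  apply Rle_trans with (sum_n (fun n => plus
    ((fun p => mi_term (D (fst p)) (snd p)) (Cantor.of_nat n)) (e n)) N).
  + apply sum_n_m_le. intros n. unfold mi_term at 1, plus. simpl.
    unfold lft, rgt. destruct (of_nat n) as (i, j) eqn:E. simpl.
    unfold mi_term. destruct (ok n) eqn:Eok;
      unfold ok in Eok; rewrite E in Eok; rewrite Eok.
    * generalize (He n). lra.
    * lra.
  + rewrite sum_n_plus. apply Rplus_le_compat.
    * apply (sum_n_of_nat_le (fun p => mi_term (D (fst p)) (snd p))
        (fun i => plus (c i) (e i))).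
      -- intros p. apply mi_term_nonneg.
      -- intros i J. simpl. destruct (HD i) as [Hi _].
         destruct (mi_length_lt_inv _ _ Hi) as (c' & Hc' & HJ).
         apply Rle_trans with c'; [apply HJ|]. unfold plus; simpl. lra.
      -- intros I. rewrite sum_n_plus. apply Rplus_le_compat; [apply HC|].
         apply sum_n_halves_le. lra.
    * apply sum_n_halves_le. lra.
- intros x (i & Hx). destruct (proj2 (HD i) x Hx) as (j & Hj & Hxj).
  exists (Cantor.to_nat (i, j)). split; [easy|].
  cbn [mi_left mi_right]. unfold lft, rgt, ok. rewrite cancel_of_to, Hj. exact Hxj.
Qed.

Lemma outer_le_union (A B : R -> Prop) (a b : R) :
  outer_le A a -> outer_le B b -> outer_le (fun x => A x \/ B x) (a + b).
Proof.
intros HA HB.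
assert (Ha := outer_le_nonneg _ _ HA). assert (Hb := outer_le_nonneg _ _ HB).
apply outer_le_mono with (fun x => exists i : nat,
  (match i with O => A | 1%nat => B | _ => fun _ => False end) x) (a + b).
- intros x [H|H]; [now exists 0%nat|now exists 1%nat].
- lra.
- apply outer_le_countable_union with
    (c := fun i => match i with O => a | 1%nat => b | _ => 0 end).
  + intros [|[|i]]; [assumption|assumption|]. now apply outer_le_empty.
  + intros N. induction N as [|[|N] IH].
    * rewrite sum_O. lra.
    * rewrite sum_Sn, sum_O. unfold plus; simpl. lra.
    * rewrite sum_Sn. unfold plus; simpl. lra.
Qed.

(** * Integrals of continuous functions that are small off a small set *)

Lemma le_of_le_eps (x y K : R) :
  0 <= K -> (forall eps, 0 < eps -> x <= y + eps * K) -> x <= y.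
Proof.
intros HK H. apply Rnot_lt_le. intros Hlt.
assert (0 < (x - y) / (2 * (K + 1))) as He.
{ apply Rdiv_lt_0_compat; lra. }
specialize (H _ He).
assert ((x - y) / (2 * (K + 1)) * (K + 1) = (x - y) / 2) by (field; lra).
nra.
Qed.

Lemma RInt_Chasles_cont (g : R -> R) (s m t : R) :
  (forall x, continuous g x) -> RInt g s t = RInt g s m + RInt g m t.
Proof.
intros Hg. symmetry. apply (RInt_Chasles g s m t); now apply ex_RInt_cont.
Qed.

Lemma abs_RInt_le_cont (g : R -> R) (s t C : R) :
  (forall x, continuous g x) -> s <= t ->
  (forall x, s <= x <= t -> Rabs (g x) <= C) ->
  Rabs (RInt g s t) <= C * (t - s).
Proof.
intros Hg Hst HC. rewrite Rmult_comm. apply abs_RInt_le_const; auto.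
now apply ex_RInt_cont.
Qed.

(** Off the cover [D] of [A] the bound [eta + eps] holds locally; inside an
    interval of [D] the bound [C] holds, and the segment there is paid for by
    the length of that interval.  By continuous induction finitely many
    intervals of [D] suffice. *)
Lemma abs_RInt_le_off (g : R -> R) (h k C eta c : R) (A : R -> Prop) :
  h <= k -> (forall x, continuous g x) ->
  (forall x, segment h k x -> Rabs (g x) <= C) ->
  outer_le A c -> 0 <= eta ->
  (forall x, segment h k x -> ~ A x -> Rabs (g x) <= eta) ->
  Rabs (RInt g h k) <= eta * (k - h) + C * c.
Proof.
intros hk Hg HC HA Heta Hoff.
assert (HC0 : 0 <= C).
{ apply Rle_trans with (Rabs (g h)); [apply Rabs_pos|].
  apply HC. split; lra. }
apply le_of_le_eps with ((k - h) + C); [lra|].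
intros eps Heps.
destruct (HA eps Heps) as (D & HD & HAD).
destruct (mi_length_lt_inv _ _ HD) as (c' & Hc' & Hsum).
(* The length of the part of the n-th interval of D between s and t: an
   additive function of the segment, as continuous induction requires. *)
set (inc := fun s t n => if index_in (mi_last D) n
  then clamp (mi_left D n) (mi_right D n) t
       - clamp (mi_left D n) (mi_right D n) s else 0).
assert (Hinc : forall s t n, s <= t -> 0 <= inc s t n).
{ intros s t n Hst. unfold inc. destruct index_in; [|lra].
  generalize (clamp_incr (mi_left D n) (mi_right D n) s t Hst). lra. }
assert (Hmon : forall s t N N', s <= t -> (N <= N')%nat ->
  sum_n (inc s t) N <= sum_n (inc s t) N').
{ intros s t N N' Hst HN. induction HN as [|N' HN IH]; [lra|].
  apply Rle_trans with (1 := IH), sum_n_incr. auto. }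
assert (HQ : exists N, Rabs (RInt g h k) <=
                         (eta + eps) * (k - h) + C * sum_n (inc h k) N).
{ apply (cousin (fun s t => exists N, Rabs (RInt g s t) <=
           (eta + eps) * (t - s) + C * sum_n (inc s t) N)); [exact hk| |].
  - intros s m t Hs Ht (N1 & H1) (N2 & H2). exists (N1 + N2)%nat.
    rewrite (RInt_Chasles_cont g s m t Hg).
    apply Rle_trans with (1 := Rabs_triang _ _).
    assert (E : sum_n (inc s t) (N1 + N2) =
              sum_n (inc s m) (N1 + N2) + sum_n (inc m t) (N1 + N2)).
    { transitivity (sum_n (fun n => plus (inc s m n) (inc m t n)) (N1 + N2)).
      - apply sum_n_ext. intros n. unfold inc, plus; simpl.
        destruct index_in; lra.
      - now rewrite sum_n_plus. }
    rewrite E.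
    assert (M1 := Hmon s m N1 (N1 + N2)%nat ltac:(lra) ltac:(lia)).
    assert (M2 := Hmon m t N2 (N1 + N2)%nat ltac:(lra) ltac:(lia)).
    nra.
  - intros x Hx. destruct (classic (mi_union D x)) as [(n & Hn & Hxn)|Hn].
    + exists (Rmin (x - mi_left D n) (mi_right D n - x)). split.
      { apply Rmin_pos; lra. }
      intros s t Hs Ht Hs' Ht'.
      assert (B1 := Rmin_l (x - mi_left D n) (mi_right D n - x)).
      assert (B2 := Rmin_r (x - mi_left D n) (mi_right D n - x)).
      exists n. apply Rle_trans with (C * (t - s)).
      * apply abs_RInt_le_cont; [exact Hg|lra|].
        intros y Hy. apply HC. split; lra.
      * assert (t - s <= sum_n (inc s t) n); [|nra].
        apply Rle_trans with (inc s t n).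
        -- unfold inc. rewrite Hn. rewrite !clamp_id; lra.
        -- destruct n as [|n]; [rewrite sum_O; lra|].
           rewrite sum_Sn. unfold plus; simpl.
           assert (0 <= sum_n (inc s t) n); [|lra].
           rewrite <- (Rmult_0_r (INR (S n))), <- sum_n_const.
           apply sum_n_m_le. intros i. apply Hinc. lra.
    + destruct (proj1 (continuous_iff g x) (Hg x) eps Heps) as (d & Hd & Hnear).
      exists d. split; [exact Hd|]. intros s t Hs Ht Hs' Ht'. exists 0%nat.
      apply Rle_trans with ((eta + eps) * (t - s)).
      * apply abs_RInt_le_cont; [exact Hg|lra|].
        intros y Hy.
        assert (Rabs (g x) <= eta) by (apply Hoff; auto; split; lra).
        assert (Rabs (g y - g x) < eps).
        { apply Hnear. apply Rabs_def1; lra. }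
        replace (g y) with (g x + (g y - g x)) by lra.
        apply Rle_trans with (1 := Rabs_triang _ _). lra.
      * assert (0 <= sum_n (inc s t) 0); [|nra].
        rewrite sum_O. apply Hinc. lra. }
destruct HQ as (N & HN).
assert (sum_n (inc h k) N <= c').
{ apply Rle_trans with (2 := Hsum N). apply sum_n_m_le. intros n.
  unfold inc, mi_term. destruct index_in eqn:E; [|lra].
  assert (L := mi_lt D n E).
  generalize (clamp_in (mi_left D n) (mi_right D n) k ltac:(lra)).
  generalize (clamp_in (mi_left D n) (mi_right D n) h ltac:(lra)). lra. }
nra.
Qed.

(** Chebyshev's inequality for outer measure.  Near a point with [lam <= u x] we
    have [lam / 2 < u], so covering a whole small segment costs at most
    [2 / lam] times the integral over it; near any other point nothing is to be
    covered. *)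
Lemma outer_le_chebyshev (u : R -> R) (h k lam : R) :
  h <= k -> 0 < lam -> (forall x, continuous u x) ->
  (forall x, segment h k x -> 0 <= u x) ->
  outer_le (fun x => segment h k x /\ lam <= u x) (2 / lam * RInt u h k).
Proof.
intros hk Hlam Hu Hpos.
assert (Hl : 0 < 2 / lam) by (apply Rdiv_lt_0_compat; lra).
apply (cousin (fun s t => outer_le (fun x => segment s t x /\ lam <= u x)
                            (2 / lam * RInt u s t))); [exact hk| |].
- intros s m t Hs Ht H1 H2.
  apply outer_le_mono with (3 := outer_le_union _ _ _ _ H1 H2).
  + intros x [Hx Hux]. unfold segment in *.
    destruct (Rle_lt_dec x m); [left|right]; lra.
  + rewrite (RInt_Chasles_cont u s m t Hu). lra.
- intros x Hx. destruct (Rle_lt_dec lam (u x)) as [Hux|Hux].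
  + destruct (proj1 (continuous_iff u x) (Hu x) (lam / 2)) as (d & Hd & Hnear);
      [lra|].
    exists d. split; [exact Hd|]. intros s t Hs Ht Hs' Ht'.
    apply outer_le_mono with (segment s t) (t - s); [tauto| |].
    2: { apply outer_le_segment. lra. }
    apply Rle_trans with (2 / lam * RInt (fun _ => lam / 2) s t).
    { rewrite RInt_const. unfold scal; simpl. unfold mult; simpl.
      right. field. lra. }
    apply Rmult_le_compat_l; [lra|]. apply RInt_le.
    * lra.
    * apply ex_RInt_const.
    * now apply ex_RInt_cont.
    * intros y Hy. assert (H : Rabs (u y - u x) < lam / 2).
      { apply Hnear. apply Rabs_def1; lra. }
      apply Rabs_def2 in H. lra.
  + destruct (proj1 (continuous_iff u x) (Hu x) (lam - u x))
      as (d & Hd & Hnear); [lra|].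
    exists d. split; [exact Hd|]. intros s t Hs Ht Hs' Ht'.
    apply outer_le_mono with (3 := outer_le_segment 0 0 (Rle_refl 0)).
    * intros y [Hy Huy]. unfold segment in Hy.
      assert (H : Rabs (u y - u x) < lam - u x).
      { apply Hnear. apply Rabs_def1; lra. }
      apply Rabs_def2 in H. lra.
    * rewrite Rminus_0_r. apply Rmult_le_pos; [lra|].
      apply RInt_ge_0; [lra|now apply ex_RInt_cont|].
      intros y Hy. apply Hpos. split; lra.
Qed.

(** * Egorov's theorem for continuous functions *)

(** The integrals of the [psi N] converge, so those of [psi N - psi N0] are
    small for large [N0], uniformly in [N].  Chebyshev's inequality bounds each
    superlevel set of these differences, but not their increasing union over
    [N].  The difference is therefore split along a subsequence [idx]
    into increments so small that the [j]-th one exceeds [eta / 2 ^ (j + 1)]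
    only on a set of outer measure [eps / 2 ^ (j + 1)]. *)
Lemma almost_uniform_of_monotone (psi : nat -> R -> R) (h k C : R) :
  h <= k -> (forall N x, continuous (psi N) x) ->
  (forall N x, psi N x <= psi (S N) x) ->
  (forall N x, segment h k x -> psi N x <= C) ->
  forall eta eps, 0 < eta -> 0 < eps -> exists N0,
    outer_le (fun x => segment h k x /\ exists N, psi N0 x + eta < psi N x) eps.
Proof.
intros hk Hcont Hincr HC eta eps Heta Heps.
assert (Hmon : forall x m n, (m <= n)%nat -> psi m x <= psi n x).
{ intros x m n Hmn. induction Hmn as [|n Hmn IH]; [lra|].
  now apply Rle_trans with (1 := IH). }
set (I := fun N => RInt (psi N) h k).
assert (HI : forall m n, (m <= n)%nat -> I m <= I n).
{ intros m n Hmn. apply RInt_le; [lra|now apply ex_RInt_cont..|].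
  intros x _. now apply Hmon. }
destruct (ex_finite_lim_seq_incr I (C * (k - h))) as (l & Hlim).
{ intros n. apply HI. lia. }
{ intros n. replace (C * (k - h)) with (RInt (fun _ => C) h k).
  - apply RInt_le; [lra|now apply ex_RInt_cont|apply ex_RInt_const|].
    intros x Hx. apply HC. split; lra.
  - rewrite RInt_const. unfold scal; simpl. unfold mult; simpl. lra. }
assert (HIl : forall n, I n <= l).
{ apply (is_lim_seq_incr_compare I l Hlim). intros n. apply HI. lia. }
set (lam := fun j => eta * (/ 2) ^ S j).
assert (Hlam : forall j, 0 < lam j).
{ intros j. apply Rmult_lt_0_compat; [lra|]. apply pow_lt. lra. }
set (e := fun j => eps * (/ 2) ^ S j).
assert (He : forall j, 0 < e j).
{ intros j. apply Rmult_lt_0_compat; [lra|]. apply pow_lt. lra. }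
(* Chebyshev's inequality turns this rate into outer measure e j for the set
   where the j-th increment is at least lam j. *)
destruct (functional_choice (fun j M => l - I M <= e j * lam j / 2))
  as (M & HM).
{ intros j.
  assert (Hp : 0 < e j * lam j / 2).
  { assert (0 < e j * lam j) by now apply Rmult_lt_0_compat. lra. }
  destruct (proj2 (is_lim_seq_spec I l) Hlim (mkposreal _ Hp)) as (m & Hm).
  exists m. specialize (Hm m (le_n m)). simpl in Hm. apply Rabs_def2 in Hm.
  lra. }
set (idx := nat_rect (fun _ => nat) (M 0%nat)
              (fun j n => Nat.max (S n) (M (S j)))).
assert (HidxM : forall j, (M j <= idx j)%nat).
{ intros [|j]; [apply le_n|apply Nat.le_max_r]. }
assert (HidxS : forall j, (idx j < idx (S j))%nat).
{ intros j. apply Nat.le_max_l. }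
assert (Hidx : forall j, (j <= idx j)%nat).
{ induction j as [|j IH]; [lia|]. generalize (HidxS j). lia. }
exists (idx 0%nat).
apply outer_le_mono with (fun x => exists j, segment h k x /\
    lam j <= psi (idx (S j)) x - psi (idx j) x) eps; [|lra|].
- intros x [Hx (N & HN)]. apply NNPP. intros Hno.
  assert (Hsmall : forall J, psi (idx J) x <=
                     psi (idx 0%nat) x + eta * (1 - (/ 2) ^ J)).
  { induction J as [|J IH]; [rewrite pow_O; lra|].
    assert (psi (idx (S J)) x - psi (idx J) x < lam J).
    { apply Rnot_le_lt. intros Hle. apply Hno. now exists J. }
    unfold lam in H. rewrite <- tech_pow_Rmult in H |- *. lra. }
  assert (H1 := Hsmall N). assert (H2 := Hmon x N (idx N) (Hidx N)).
  assert (0 < (/ 2) ^ N) by (apply pow_lt; lra). nra.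
- apply outer_le_countable_union with (c := e).
  2: { intros N. apply sum_n_halves_le. lra. }
  intros j.
  assert (Hdiff : forall x,
    continuous (fun x => psi (idx (S j)) x - psi (idx j) x) x).
  { intros x. apply (continuous_minus (psi (idx (S j))) (psi (idx j)) x); apply Hcont. }
  apply outer_le_mono with (3 := outer_le_chebyshev
    (fun x => psi (idx (S j)) x - psi (idx j) x) h k (lam j) hk (Hlam j) Hdiff
    ltac:(intros x _; generalize (Hmon x _ _ (Nat.lt_le_incl _ _ (HidxS j))); lra)); [auto|].
  replace (RInt (fun x => psi (idx (S j)) x - psi (idx j) x) h k)
    with (I (idx (S j)) - I (idx j)).
  2: { symmetry. apply (RInt_minus (psi (idx (S j))) (psi (idx j)));
       now apply ex_RInt_cont. }
  apply Rle_trans with (2 / lam j * (e j * lam j / 2)).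
  + apply Rmult_le_compat_l.
    { left. apply Rdiv_lt_0_compat; [lra|apply Hlam]. }
    generalize (HM j) (HIl (idx (S j))) (HI _ _ (HidxM j)). lra.
  + right. field. generalize (Hlam j). lra.
Qed.

(** Comparing with the single term [phi j], rather than all pairs of later terms,
    keeps this a one-parameter recursion; at most a factor 2 is lost. *)
Fixpoint max_deviation (phi : nat -> R -> R) (j N : nat) (x : R) : R :=
  match N with
  | O => 0
  | S N => Rmax (max_deviation phi j N x) (Rabs (phi (j + N)%nat x - phi j x))
  end.

Lemma continuous_Rmax (f g : R -> R) (x : R) :
  continuous f x -> continuous g x -> continuous (fun y => Rmax (f y) (g y)) x.
Proof.
intros Hf Hg. apply continuous_iff. intros eps Heps.
destruct (proj1 (continuous_iff f x) Hf eps Heps) as (d1 & Hd1 & H1).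
destruct (proj1 (continuous_iff g x) Hg eps Heps) as (d2 & Hd2 & H2).
exists (Rmin d1 d2). split; [now apply Rmin_pos|]. intros y Hy.
assert (A1 : Rabs (f y - f x) < eps).
{ apply H1. apply Rlt_le_trans with (1 := Hy), Rmin_l. }
assert (A2 : Rabs (g y - g x) < eps).
{ apply H2. apply Rlt_le_trans with (1 := Hy), Rmin_r. }
apply Rabs_def2 in A1. apply Rabs_def2 in A2.
apply Rabs_def1; unfold Rmax; repeat destruct Rle_dec; lra.
Qed.

Lemma continuous_max_deviation (phi : nat -> R -> R) (j N : nat) (x : R) :
  (forall n, continuous (phi n) x) -> continuous (max_deviation phi j N) x.
Proof.
intros H. induction N as [|N IH]; simpl; [apply continuous_const|].
apply continuous_Rmax; [exact IH|].
apply (continuous_comp (fun y => phi (j + N)%nat y - phi j y) Rabs).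
- apply (continuous_minus (phi (j + N)%nat) (phi j) x); apply H.
- apply continuous_Rabs.
Qed.

Lemma max_deviation_le (phi : nat -> R -> R) (j N : nat) (x b : R) :
  0 <= b -> (forall i, Rabs (phi (j + i)%nat x - phi j x) <= b) ->
  max_deviation phi j N x <= b.
Proof.
intros Hb H. induction N as [|N IH]; simpl; [lra|].
apply Rmax_lub; auto.
Qed.

(** Choose [N0 j] such that, off a small set, no deviation from [phi j] exceeds by
    more than [eta / 4] the one of index [N0 j].  Let [D] cover the union of
    these sets and [A].  A point off [D] is a point of convergence, so it has a
    neighbourhood where the deviation of index [N0 j] is less than [eta / 4],
    for some [j]; by compactness finitely many [j] serve the whole segment.  Off
    [D], that single bound controls all the terms after [j]. *)
Lemma egorov_continuous (phi : nat -> R -> R) (h k C c : R) (A : R -> Prop) :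
  h <= k -> (forall n x, continuous (phi n) x) ->
  (forall n x, segment h k x -> Rabs (phi n x) <= C) ->
  outer_le A c ->
  (forall x, segment h k x -> ~ A x -> ex_finite_lim_seq (fun n => phi n x)) ->
  forall eta eps, 0 < eta -> 0 < eps -> exists n,
    outer_le (fun x => segment h k x /\ exists m p, (n <= m)%nat /\
      (n <= p)%nat /\ eta < Rabs (phi m x - phi p x)) (c + eps).
Proof.
intros hk Hcont HC HA Hcvg eta eps Heta Heps.
set (e := fun j => eps / 2 * (/ 2) ^ S j).
assert (HN : forall j, exists N0, outer_le (fun x => segment h k x /\
  exists N, max_deviation phi j N0 x + eta / 4 < max_deviation phi j N x) (e j)).
{ intros j. apply almost_uniform_of_monotone with (2 * C).
  - exact hk.
  - intros N x. apply continuous_max_deviation. auto.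
  - intros N x. apply Rmax_l.
  - intros N x Hx.
    assert (0 <= C) by (apply Rle_trans with (2 := HC 0%nat x Hx), Rabs_pos).
    apply max_deviation_le; [lra|]. intros i.
    apply Rle_trans with (1 := Rabs_triang _ _). rewrite Rabs_Ropp.
    generalize (HC (j + i)%nat x Hx) (HC j x Hx). lra.
  - lra.
  - apply Rmult_lt_0_compat; [lra|]. apply pow_lt. lra. }
destruct (functional_choice _ HN) as (N0 & HN0).
assert (HU := outer_le_union _ _ _ _ HA
  (outer_le_countable_union _ e (eps / 2) HN0
     ltac:(intros N; apply sum_n_halves_le; lra))).
destruct (HU (eps / 2)) as (D & HD & HUD); [lra|].
assert (HQ : exists n, forall x, segment h k x -> mi_union D x \/
          exists j, (j <= n)%nat /\ max_deviation phi j (N0 j) x < eta / 4).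
{ apply (cousin (fun s t => exists n, forall x, segment s t x -> mi_union D x \/
     exists j, (j <= n)%nat /\ max_deviation phi j (N0 j) x < eta / 4));
    [exact hk| |].
  - intros s m t Hs Ht (n1 & H1) (n2 & H2). exists (n1 + n2)%nat.
    intros x Hx.
    destruct (Rle_lt_dec x m) as [Hxm|Hxm].
    + destruct (H1 x) as [H|(j & Hj & H)]; [unfold segment in *; lra|auto|].
      right. exists j. split; [lia|exact H].
    + destruct (H2 x) as [H|(j & Hj & H)]; [unfold segment in *; lra|auto|].
      right. exists j. split; [lia|exact H].
  - intros x Hx. destruct (classic (mi_union D x)) as [(n & Hn & Hxn)|Hn].
    + exists (Rmin (x - mi_left D n) (mi_right D n - x)). split.
      { apply Rmin_pos; lra. }
      intros s t Hs Ht Hs' Ht'.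
      assert (B1 := Rmin_l (x - mi_left D n) (mi_right D n - x)).
      assert (B2 := Rmin_r (x - mi_left D n) (mi_right D n - x)).
      exists 0%nat. intros y Hy. left. exists n. unfold segment in Hy.
      split; [exact Hn|lra].
    + destruct (Hcvg x Hx) as (l & Hl); [auto|].
      destruct (proj2 (is_lim_seq_spec _ _) Hl (mkposreal (eta / 16) ltac:(lra)))
        as (j & Hj). simpl in Hj.
      assert (Hdev : max_deviation phi j (N0 j) x < eta / 4).
      { apply Rle_lt_trans with (eta / 8); [|lra].
        apply max_deviation_le; [lra|]. intros i.
        assert (H1 := Hj (j + i)%nat ltac:(lia)). assert (H2 := Hj j ltac:(lia)).
        apply Rabs_def2 in H1. apply Rabs_def2 in H2. apply Rabs_le. lra. }
      destruct (proj1 (continuous_iff _ _)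
        (continuous_max_deviation phi j (N0 j) x (fun n => Hcont n x))
        (eta / 4 - max_deviation phi j (N0 j) x)) as (d & Hd & Hnear); [lra|].
      exists d. split; [exact Hd|]. intros s t Hs Ht Hs' Ht'.
      exists j. intros y Hy. right. exists j. split; [lia|].
      unfold segment in Hy.
      assert (H := Hnear y ltac:(apply Rabs_def1; lra)).
      apply Rabs_def2 in H. lra. }
destruct HQ as (n & Hn). exists n.
apply outer_le_mono with (mi_union D) (c + eps); [|lra|].
2: { apply outer_le_union_of.
     replace (c + eps) with (c + eps / 2 + eps / 2) by lra. exact HD. }
intros x (Hx & m & p & Hm & Hp & Hmp).
destruct (Hn x Hx) as [H|(j & Hj & Hdev)]; [exact H|].
apply NNPP. intros HxD.
assert (Hall : forall N, max_deviation phi j N x <= eta / 2).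
{ intros N. apply Rnot_lt_le. intros HN'. apply HxD, HUD. right.
  exists j. split; [exact Hx|]. exists N. lra. }
assert (Hdv : forall q, (n <= q)%nat -> Rabs (phi q x - phi j x) <= eta / 2).
{ intros q Hq. apply Rle_trans with (2 := Hall (S (q - j))). simpl.
  replace (j + (q - j))%nat with q by lia. apply Rmax_r. }
assert (H1 := Hdv m Hm). assert (H2 := Hdv p Hp).
apply Rabs_le_between in H1. apply Rabs_le_between in H2.
assert (Rabs (phi m x - phi p x) <= eta); [|lra]. apply Rabs_le. lra.
Qed.

(** * Extension of continuous functions from closed subsets of the line *)

(** [G x] is the infimum of [w y * |x - y|] over [y] in [F]; for [w = 1] it is the
    distance from [x] to [F]. *)
Definition weighted_distance (F : R -> Prop) (w G : R -> R) : Prop :=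
  forall x, (forall y, F y -> G x <= w y * Rabs (x - y)) /\
    (forall b, (forall y, F y -> b <= w y * Rabs (x - y)) -> b <= G x).

Lemma ex_weighted_distance (F : R -> Prop) (w : R -> R) :
  (exists y, F y) -> (forall y, F y -> 0 <= w y) ->
  exists G : R -> R, weighted_distance F w G.
Proof.
intros (y0 & Hy0) Hw.
apply (functional_choice (fun x g =>
    (forall y, F y -> g <= w y * Rabs (x - y)) /\
    (forall b, (forall y, F y -> b <= w y * Rabs (x - y)) -> b <= g))).
intros x.
destruct (completeness (fun v => exists y, F y /\ v = - (w y * Rabs (x - y))))
  as (s & Hub & Hlub).
- exists 0. intros v (y & Hy & ->).
  assert (0 <= w y * Rabs (x - y)); [|lra].
  apply Rmult_le_pos; [auto|apply Rabs_pos].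
- now exists (- (w y0 * Rabs (x - y0))), y0.
- exists (- s). split.
  + intros y Hy. assert (- (w y * Rabs (x - y)) <= s); [|lra].
    apply Hub. now exists y.
  + intros b Hb. assert (s <= - b); [|lra].
    apply Hlub. intros v (y & Hy & ->). generalize (Hb y Hy). lra.
Qed.

Lemma weighted_distance_lipschitz (F : R -> Prop) (w G : R -> R) (B : R) :
  weighted_distance F w G ->
  (forall y, F y -> 0 <= w y <= B) ->
  forall x z, G z - B * Rabs (x - z) <= G x.
Proof.
intros HG Hw x z. apply HG. intros y Hy.
apply Rle_trans with (w y * Rabs (z - y) - w y * Rabs (x - z)).
- assert (H := proj1 (HG z) y Hy). assert (0 <= Rabs (x - z)) by apply Rabs_pos.
  specialize (Hw y Hy). nra.
- rewrite <- Rmult_minus_distr_l. apply Rmult_le_compat_l; [now apply Hw|].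
  assert (H := Rabs_triang (z - x) (x - y)).
  replace (z - x + (x - y)) with (z - y) in H by lra.
  rewrite (Rabs_minus_sym z x) in H. lra.
Qed.

Lemma weighted_distance_continuous (F : R -> Prop) (w G : R -> R) (B : R) :
  weighted_distance F w G ->
  0 < B -> (forall y, F y -> 0 <= w y <= B) -> forall x, continuous G x.
Proof.
intros HG HB Hw x. apply continuous_iff. intros eps Heps.
exists (eps / B). split; [now apply Rdiv_lt_0_compat|]. intros y Hy.
assert (H1 := weighted_distance_lipschitz F w G B HG Hw x y).
assert (H2 := weighted_distance_lipschitz F w G B HG Hw y x).
rewrite Rabs_minus_sym in H1.
assert (B * Rabs (y - x) < eps).
{ apply Rmult_lt_compat_l with (r := B) in Hy; [|lra].
  replace (B * (eps / B)) with eps in Hy by (field; lra). exact Hy. }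
apply Rabs_def1; lra.
Qed.

(** Off [F] the extension is [G / G1], where [G] and [G1] are the distances to [F]
    weighted by [w] and by [1] (Dieudonne's formula).  A quotient of
    continuous functions with positive denominator is continuous off [F].  Near a
    point [x] of [F], the [y] far from [x] do not influence the quotient because
    [w] is bounded away from [0] and from infinity, and for the others [w y] is
    close to [w x].  That the quotient stays between the bounds of [w] is seen
    directly on the formula. *)
Lemma tietze_positive (F : R -> Prop) (w : R -> R) (m B : R) :
  (exists y, F y) ->
  (forall x, ~ F x -> exists d, 0 < d /\ forall y, F y -> d <= Rabs (x - y)) ->
  0 < m -> (forall y, F y -> m <= w y <= B) -> continuous_on F w ->
  exists phi : R -> R, (forall x, continuous phi x) /\
    (forall x, F x -> phi x = w x) /\
    (forall b, (forall y, F y -> b <= w y) -> forall x, b <= phi x) /\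
    (forall b, (forall y, F y -> w y <= b) -> forall x, phi x <= b).
Proof.
intros HF Hclosed Hm Hw Hcont.
assert (HB : m <= B) by (destruct HF as (y & Hy); generalize (Hw y Hy); lra).
destruct (ex_weighted_distance F w HF) as (G & HG).
{ intros y Hy. generalize (Hw y Hy). lra. }
destruct (ex_weighted_distance F (fun _ => 1) HF) as (G1 & HG1).
{ intros. lra. }
assert (HG1pos : forall x, ~ F x -> 0 < G1 x).
{ intros x Hx. destruct (Hclosed x Hx) as (d & Hd & H).
  apply Rlt_le_trans with (1 := Hd). apply HG1. intros y Hy.
  rewrite Rmult_1_l. auto. }
destruct (functional_choice (fun x v => (F x -> v = w x) /\
  (~ F x -> v * G1 x = G x))) as (phi & Hphi).
{ intros x. destruct (classic (F x)) as [Hx|Hx].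
  - exists (w x). tauto.
  - exists (G x / G1 x). split; [tauto|]. intros _. field.
    generalize (HG1pos x Hx). lra. }
exists phi. split; [|split; [|split]].
- intros x. destruct (classic (F x)) as [Hx|Hx].
  + apply continuous_iff. intros eps Heps.
    destruct (proj1 (continuous_on_iff F w) Hcont x Hx (eps / 2))
      as (d & Hd & Hnear); [lra|].
    (* At distance less than r from x, a y with d <= |y - x| has
       w y * |z - y| >= m * (d - r) = B * r >= w x * |z - x|. *)
    set (r := m * d / (B + m)).
    assert (Er : r * (B + m) = m * d) by (unfold r; field; lra).
    assert (Hr : 0 < r).
    { apply Rdiv_lt_0_compat; [|lra]. now apply Rmult_lt_0_compat. }
    clearbody r.
    assert (Hr2 : 2 * r <= d) by nra.
    exists r. split; [exact Hr|]. intros z Hz.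
    rewrite (proj1 (Hphi x) Hx).
    destruct (classic (F z)) as [Hz'|Hz'].
    { rewrite (proj1 (Hphi z) Hz').
      apply Rlt_trans with (eps / 2); [|lra]. apply Hnear; [exact Hz'|lra]. }
    assert (Ez := proj2 (Hphi z) Hz'). assert (Dpos := HG1pos z Hz').
    assert (Hwx := Hw x Hx).
    assert (Hcase : forall y, F y -> Rabs (w y - w x) < eps / 2 \/
                      d - r <= Rabs (z - y)).
    { intros y Hy. destruct (Rlt_le_dec (Rabs (y - x)) d) as [H|H]; [auto|].
      right. assert (H' := Rabs_triang (y - z) (z - x)).
      replace (y - z + (z - x)) with (y - x) in H' by lra.
      rewrite (Rabs_minus_sym y z) in H'. lra. }
    assert (HDle : forall y, F y -> G1 z <= Rabs (z - y)).
    { intros y Hy. rewrite <- Rmult_1_l. now apply HG1. }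
    assert (HD := HDle x Hx).
    assert (Hlow : (w x - eps / 2) * G1 z <= G z).
    { apply HG. intros y Hy. assert (Hwy := Hw y Hy).
      assert (HDy := HDle y Hy).
      destruct (Hcase y Hy) as [H|H].
      - apply Rabs_def2 in H. nra.
      - nra. }
    assert (Hup : G z <= (w x + eps / 2) * G1 z).
    { apply Rmult_le_reg_l with (/ (w x + eps / 2)).
      { apply Rinv_0_lt_compat. lra. }
      rewrite <- Rmult_assoc, Rinv_l, Rmult_1_l; [|lra].
      apply HG1. intros y Hy. rewrite Rmult_1_l.
      apply Rmult_le_reg_l with (w x + eps / 2); [lra|].
      rewrite <- Rmult_assoc, Rinv_r, Rmult_1_l; [|lra].
      assert (H0 := Rabs_pos (z - y)).
      destruct (Hcase y Hy) as [H|H].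
      - apply Rle_trans with (1 := proj1 (HG z) y Hy).
        apply Rabs_def2 in H. apply Rmult_le_compat_r; lra.
      - apply Rle_trans with (1 := proj1 (HG z) x Hx). nra. }
    assert (phi z <= w x + eps / 2) by (apply Rmult_le_reg_r with (G1 z); lra).
    assert (w x - eps / 2 <= phi z) by (apply Rmult_le_reg_r with (G1 z); lra).
    apply Rabs_def1; lra.
  + destruct (Hclosed x Hx) as (d & Hd & Hfar).
    apply continuous_ext_loc with (fun z => G z * / G1 z).
    * exists (mkposreal d Hd). intros z Hz.
      assert (Hz' : ~ F z).
      { intros Hz'. generalize (Hfar z Hz'). rewrite Rabs_minus_sym.
        change (Rabs (z - x) < d) in Hz. lra. }
      assert (E : G z * / G1 z = phi z); [|exact E].
      rewrite <- (proj2 (Hphi z) Hz'). field. generalize (HG1pos z Hz'). lra.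
    * apply (continuous_mult G (fun z => / G1 z)).
      -- apply (weighted_distance_continuous F w G B HG); [lra|].
         intros y Hy. generalize (Hw y Hy). lra.
      -- apply (continuous_comp G1 Rinv).
         ++ apply (weighted_distance_continuous F _ G1 1 HG1); [lra|].
            intros. lra.
         ++ apply continuous_Rinv. generalize (HG1pos x Hx). lra.
- intros x Hx. now apply Hphi.
- intros b Hb x. destruct (classic (F x)) as [Hx|Hx].
  { rewrite (proj1 (Hphi x) Hx). auto. }
  assert (E := proj2 (Hphi x) Hx). assert (P := HG1pos x Hx).
  apply Rmult_le_reg_r with (G1 x); [exact P|]. rewrite E. apply HG.
  intros y Hy. assert (H1 := proj1 (HG1 x) y Hy).
  assert (H2 := Hb y Hy). assert (H3 := Hw y Hy). nra.
- intros b Hb x. destruct (classic (F x)) as [Hx|Hx].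
  { rewrite (proj1 (Hphi x) Hx). auto. }
  assert (E := proj2 (Hphi x) Hx). assert (P := HG1pos x Hx).
  assert (Hb0 : 0 < b).
  { destruct HF as (y & Hy). generalize (Hb y Hy) (Hw y Hy). lra. }
  apply Rmult_le_reg_r with (G1 x); [exact P|]. rewrite E.
  apply Rmult_le_reg_l with (/ b); [now apply Rinv_0_lt_compat|].
  rewrite <- Rmult_assoc, Rinv_l, Rmult_1_l; [|lra].
  apply HG1. intros y Hy. rewrite Rmult_1_l.
  apply Rmult_le_reg_l with b; [lra|].
  rewrite <- Rmult_assoc, Rinv_r, Rmult_1_l; [|lra].
  apply Rle_trans with (1 := proj1 (HG x) y Hy).
  apply Rmult_le_compat_r; [apply Rabs_pos|auto].
Qed.

Lemma tietze_bounded (F : R -> Prop) (f : R -> R) (C : R) :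
  (exists y, F y) ->
  (forall x, ~ F x -> exists d, 0 < d /\ forall y, F y -> d <= Rabs (x - y)) ->
  (forall y, F y -> Rabs (f y) <= C) -> continuous_on F f ->
  exists phi : R -> R, (forall x, continuous phi x) /\
    (forall x, F x -> phi x = f x) /\
    (forall b, (forall y, F y -> b <= f y) -> forall x, b <= phi x) /\
    (forall b, (forall y, F y -> f y <= b) -> forall x, phi x <= b).
Proof.
intros HF Hclosed HC Hcont.
destruct (tietze_positive F (fun x => f x + (C + 1)) 1 (2 * C + 1) HF Hclosed)
  as (phi & Hphi & Hext & Hlow & Hup).
- lra.
- intros y Hy. generalize (proj1 (Rabs_le_between _ _) (HC y Hy)). lra.
- apply continuous_on_iff. intros x Hx eps Heps.
  destruct (proj1 (continuous_on_iff F f) Hcont x Hx eps Heps)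
    as (d & Hd & H).
  exists d. split; [exact Hd|]. intros y Hy Hyx.
  replace (f y + (C + 1) - (f x + (C + 1))) with (f y - f x) by lra. auto.
- exists (fun x => phi x - (C + 1)). split; [|split; [|split]].
  + intros x. apply (continuous_minus phi (fun _ => C + 1)); [auto|].
    apply continuous_const.
  + intros x Hx. rewrite Hext by exact Hx. lra.
  + intros b Hb x. assert (b + (C + 1) <= phi x); [|lra].
    apply Hlow. intros y Hy. generalize (Hb y Hy). lra.
  + intros b Hb x. assert (phi x <= b + (C + 1)); [|lra].
    apply Hup. intros y Hy. generalize (Hb y Hy). lra.
Qed.

Lemma set_off_segment_closed (h k : R) (D : multiinterval) (x : R) :
  ~ set_off (segment h k) D x -> exists d, 0 < d /\
    forall y, set_off (segment h k) D y -> d <= Rabs (x - y).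
Proof.
intros Hx. destruct (classic (segment h k x)) as [Hs|Hs].
- destruct (classic (mi_union D x)) as [(n & Hn & Hxn)|Hu].
  2: { now destruct Hx. }
  exists (Rmin (x - mi_left D n) (mi_right D n - x)). split.
  { apply Rmin_pos; lra. }
  intros y [_ Hy]. apply Rnot_lt_le. intros Hlt. apply Hy. exists n.
  split; [exact Hn|].
  assert (B1 := Rmin_l (x - mi_left D n) (mi_right D n - x)).
  assert (B2 := Rmin_r (x - mi_left D n) (mi_right D n - x)).
  apply Rabs_def2 in Hlt. lra.
- unfold segment in Hs. destruct (Rlt_le_dec x h) as [H|H].
  + exists (h - x). split; [lra|]. intros y [[Hy _] _].
    rewrite Rabs_minus_sym, Rabs_pos_eq; lra.
  + exists (x - k). split; [lra|]. intros y [[_ Hy] _].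
    rewrite Rabs_pos_eq; lra.
Qed.

(** If [D] covered the segment, the estimate [abs_RInt_le_off] for the constant [1]
    would give [k - h <= mi_length D]. *)
Lemma set_off_segment_nonempty (h k : R) (D : multiinterval) :
  h < k -> Rbar_lt (mi_length D) (k - h) ->
  exists x, set_off (segment h k) D x.
Proof.
intros hk HD. apply NNPP. intros Hno.
destruct (mi_length_lt_inv _ _ HD) as (c & Hc & Hsum).
assert (H : Rabs (RInt (fun _ => 1) h k) <= 0 * (k - h) + 1 * c).
{ apply abs_RInt_le_off with (mi_union D).
  - lra.
  - intros x. apply continuous_const.
  - intros x _. rewrite Rabs_R1. lra.
  - intros eps Heps. exists D. split; [|auto].
    apply Rbar_le_lt_trans with c; [now apply mi_length_le|simpl; lra].
  - lra.
  - intros x Hx HxD. destruct Hno. now exists x. }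
rewrite RInt_const in H. unfold scal in H; simpl in H. unfold mult in H; simpl in H.
generalize (Rle_abs ((k - h) * 1)). lra.
Qed.

(** The length of [D] must be less than [k - h]: otherwise the points off [D] may
    form the empty set, whose infimum no function on the segment shares. *)
Lemma ex_admissible_extension (f : pfun) (h k C : R) (D : multiinterval) :
  h < k -> Rbar_lt (mi_length D) (k - h) -> continuous_off f (segment h k) D ->
  (forall x, segment h k x -> pdom f x -> Rabs (f x) <= C) ->
  exists phi, (forall x, continuous phi x) /\ (forall x, Rabs (phi x) <= C) /\
    admissible_extension f (segment h k) D phi.
Proof.
intros hk HD [Hdom Hcont] HC.
assert (HCoff : forall x, set_off (segment h k) D x -> Rabs (f x) <= C).
{ intros x Hx. apply HC; [apply Hx|now apply Hdom]. }
destruct (set_off_segment_nonempty h k D hk HD) as (x0 & Hx0).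
destruct (tietze_bounded (set_off (segment h k) D) f C) as
  (phi & Hphi & Hext & Hlow & Hup); [now exists x0| |exact HCoff|exact Hcont|].
{ apply set_off_segment_closed. }
exists phi. split; [exact Hphi|]. split.
{ intros x. apply Rabs_le. split; [apply Hlow|apply Hup]; intros y Hy;
  generalize (proj1 (Rabs_le_between _ _) (HCoff y Hy)); lra. }
split; [now apply continuous_on_of_continuous|]. split; [exact Hext|]. split.
- apply is_glb_Rbar_unique.
  destruct (Glb_Rbar_correct (image f (set_off (segment h k) D))) as [Hlb Hglb].
  split.
  + intros v (x & Hx & ->).
    destruct (Glb_Rbar (image f (set_off (segment h k) D))) as [b| |]; simpl.
    * apply Hlow. intros y Hy. apply (Hlb (f y)). now exists y.
    * apply (Hlb (f x0)). now exists x0.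
    * exact I.
  + intros b Hb. apply Hglb. intros v (x & Hx & ->). rewrite <- Hext by exact Hx.
    apply Hb. exists x. split; [apply Hx|easy].
- apply is_lub_Rbar_unique.
  destruct (Lub_Rbar_correct (image f (set_off (segment h k) D))) as [Hub Hlub].
  split.
  + intros v (x & Hx & ->).
    destruct (Lub_Rbar (image f (set_off (segment h k) D))) as [b| |]; simpl.
    * apply Hup. intros y Hy. apply (Hub (f y)). now exists y.
    * exact I.
    * apply (Hub (f x0)). now exists x0.
  + intros b Hb. apply Hlub. intros v (x & Hx & ->). rewrite <- Hext by exact Hx.
    apply Hb. exists x. split; [apply Hx|easy].
Qed.

(** This is where the condition on the infimum and the supremum in the definition
    of the Tonelli integral is used: it carries the bound of [f] over to the
    extension. *)
Lemma admissible_extension_bounded (f : pfun) (I : R -> Prop)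
    (D : multiinterval) (phi : R -> R) (C : R) :
  continuous_off f I D -> (forall x, I x -> pdom f x -> Rabs (f x) <= C) ->
  admissible_extension f I D phi -> forall x, I x -> Rabs (phi x) <= C.
Proof.
intros [Hdom _] HC (_ & _ & Hglb & Hlub) x Hx.
assert (HCoff : forall y, set_off I D y -> - C <= f y <= C).
{ intros y Hy. apply Rabs_le_between. apply HC; [apply Hy|now apply Hdom]. }
apply Rabs_le. split.
- assert (H1 : Rbar_le (- C) (Glb_Rbar (image phi I))).
  { rewrite Hglb. apply Glb_Rbar_correct. intros v (y & Hy & ->).
    apply (HCoff y Hy). }
  assert (H2 : Rbar_le (Glb_Rbar (image phi I)) (phi x)).
  { apply Glb_Rbar_correct. now exists x. }
  exact (Rbar_le_trans _ _ _ H1 H2).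
- assert (H1 : Rbar_le (Lub_Rbar (image phi I)) C).
  { rewrite Hlub. apply Lub_Rbar_correct. intros v (y & Hy & ->).
    apply (HCoff y Hy). }
  assert (H2 : Rbar_le (phi x) (Lub_Rbar (image phi I))).
  { apply Lub_Rbar_correct. now exists x. }
  exact (Rbar_le_trans _ _ _ H2 H1).
Qed.

(** * Existence and approximation of the Tonelli integral *)

Lemma eventually_inv_lt (eps : R) :
  0 < eps -> exists N, forall n, (N <= n)%nat -> 1 / (INR n + 1) < eps.
Proof.
intros Heps. destruct (archimed_cor1 eps Heps) as (N & HN & HN0).
exists N. intros n Hn. apply Rle_lt_trans with (2 := HN).
unfold Rdiv. rewrite Rmult_1_l. apply Rinv_le_contravar.
- now apply lt_0_INR.
- generalize (le_INR _ _ Hn). lra.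
Qed.

Lemma inv_succ_pos (n : nat) : 0 < 1 / (INR n + 1).
Proof. generalize (pos_INR n). intros. apply Rdiv_lt_0_compat; lra. Qed.

(** Off [A] and [D], [psi] equals [f] and [phi] is within [eta] of it; elsewhere
    they differ by at most [2 * C]. *)
Lemma RInt_extension_close (f : pfun) (h k C : R) (D : multiinterval)
    (phi psi : R -> R) (A : R -> Prop) (a d eta : R) :
  h < k -> (forall x, segment h k x -> pdom f x -> Rabs (f x) <= C) ->
  continuous_off f (segment h k) D -> Rbar_lt (mi_length D) d ->
  admissible_extension f (segment h k) D psi ->
  continuous_on (segment h k) phi ->
  (forall x, segment h k x -> Rabs (phi x) <= C) ->
  outer_le A a -> 0 <= eta ->
  (forall x, segment h k x -> ~ A x -> pdom f x -> Rabs (phi x - f x) <= eta) ->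
  Rabs (RInt phi h k - RInt psi h k) <= eta * (k - h) + 2 * C * (a + d).
Proof.
intros hk HC Hoff HD Hpsi Hphi HphiC HA Heta Hclose.
assert (HpsiC := admissible_extension_bounded f _ D psi C Hoff HC Hpsi).
destruct Hpsi as (Hpsic & Hext & _).
assert (hk' : h <= k) by lra.
assert (Ec : forall u : R -> R, RInt u h k = RInt (fun x => u (clamp h k x)) h k).
{ intros u. apply RInt_ext. intros x Hx. rewrite clamp_id; [easy|].
  rewrite Rmin_left, Rmax_right in Hx; lra. }
assert (C1 := continuous_clamp h k phi hk' Hphi).
assert (C2 := continuous_clamp h k psi hk' Hpsic).
rewrite (Ec phi), (Ec psi).
rewrite <- (RInt_minus (fun x => phi (clamp h k x)) (fun x => psi (clamp h k x)))
  by now apply ex_RInt_cont.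
apply (abs_RInt_le_off _ h k (2 * C) eta (a + d) (fun x => A x \/ mi_union D x)).
- lra.
- intros x. apply (continuous_minus _ _ x (C1 x) (C2 x)).
- intros x Hx. rewrite clamp_id by exact Hx.
  apply Rle_trans with (1 := Rabs_triang _ _).
  change (Rabs (phi x) + Rabs (- psi x) <= 2 * C). rewrite Rabs_Ropp.
  generalize (HphiC x Hx) (HpsiC x Hx). lra.
- apply outer_le_union; [exact HA|now apply outer_le_union_of].
- exact Heta.
- intros x Hx HAx. rewrite clamp_id by exact Hx.
  assert (Hset : set_off (segment h k) D x) by (split; tauto).
  rewrite (Hext x Hset). apply Hclose; [exact Hx|tauto|]. now apply Hoff.
Qed.

(** The form in which the Tonelli integral is used afterwards: [phi] need not be an
    extension of [f], only close to it, and close to it off any small set. *)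
Lemma tonelli_int_close (f : pfun) (h k C l : R) (phi : R -> R)
    (A : R -> Prop) (a eta : R) :
  h < k -> (forall x, segment h k x -> pdom f x -> Rabs (f x) <= C) ->
  is_tonelli_int f h k l ->
  continuous_on (segment h k) phi ->
  (forall x, segment h k x -> Rabs (phi x) <= C) ->
  outer_le A a -> 0 <= eta ->
  (forall x, segment h k x -> ~ A x -> pdom f x -> Rabs (phi x - f x) <= eta) ->
  Rabs (RInt phi h k - l) <= eta * (k - h) + 2 * C * a.
Proof.
intros hk HC (_ & (D & psi & Hch) & Hlim) Hphi HphiC HA Heta Hclose.
assert (HC0 : 0 <= C).
{ apply Rle_trans with (Rabs (phi h)); [apply Rabs_pos|].
  apply HphiC. split; lra. }
apply le_of_le_eps with (2 * C + 1); [lra|]. intros eps Heps.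
destruct (proj2 (is_lim_seq_spec _ _) (Hlim D psi Hch) (mkposreal eps Heps))
  as (N1 & HN1). simpl in HN1.
destruct (eventually_inv_lt eps Heps) as (N2 & HN2).
set (n := (N1 + N2)%nat).
destruct (Hch n) as (HD & Hoff & Hadm).
assert (H1 := RInt_extension_close f h k C (D n) phi (psi n) A a
  (1 / (INR n + 1)) eta hk HC Hoff HD Hadm Hphi HphiC HA Heta Hclose).
assert (H2 := HN1 n ltac:(unfold n; lia)).
assert (H3 := HN2 n ltac:(unfold n; lia)).
apply Rle_trans with
  (Rabs (RInt phi h k - RInt (psi n) h k) + Rabs (RInt (psi n) h k - l)).
{ replace (RInt phi h k - l)
    with (RInt phi h k - RInt (psi n) h k + (RInt (psi n) h k - l)) by ring.
  apply Rabs_triang. }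
nra.
Qed.

(** By [RInt_extension_close] the integrals along one choice form a Cauchy
    sequence, and those along any other choice approach them. *)
Lemma ex_tonelli_int_bounded (f : pfun) (h k : R) :
  h < k -> bounded_quasicontinuous f (segment h k) -> ex_tonelli_int f h k.
Proof.
intros hk Hf. destruct (Hf) as ((_ & Hqc) & C0 & HC0).
set (C := Rabs C0).
assert (Cpos : 0 <= C) by apply Rabs_pos.
assert (HC : forall x, segment h k x -> pdom f x -> Rabs (f x) <= C).
{ intros x Hx Hd. apply Rle_trans with (1 := HC0 x Hx Hd), Rle_abs. }
clearbody C.
destruct (functional_choice (fun n Dphi =>
    Rbar_lt (mi_length (fst Dphi)) (1 / (INR n + 1)) /\
    continuous_off f (segment h k) (fst Dphi) /\
    admissible_extension f (segment h k) (fst Dphi) (snd Dphi)))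
  as (Dphi & Hch).
{ intros n. assert (P := inv_succ_pos n).
  (* A length below k - h guarantees that an extension exists. *)
  destruct (Hqc (Rmin (1 / (INR n + 1)) (k - h))) as (D & HD & Hoff).
  { apply Rmin_pos; lra. }
  destruct (ex_admissible_extension f h k C D hk) as (phi & _ & _ & Hphi);
    [|exact Hoff|exact HC|].
  { apply Rbar_lt_le_trans with (1 := HD). apply Rmin_r. }
  exists (D, phi). split; [|tauto]. simpl.
  apply Rbar_lt_le_trans with (1 := HD). apply Rmin_l. }
set (D := fun n => fst (Dphi n)). set (phi := fun n => snd (Dphi n)).
change (admissible_choice f h k D phi) in Hch. clearbody D phi. clear Dphi.
assert (Hclose : forall D' phi', admissible_choice f h k D' phi' -> forall m n,
  Rabs (RInt (phi' m) h k - RInt (phi n) h k)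
    <= 2 * C * (1 / (INR m + 1) + 1 / (INR n + 1))).
{ intros D' phi' Hch' m n.
  destruct (Hch n) as (HD & Hoff & Hadm).
  destruct (Hch' m) as (HD' & Hoff' & Hadm').
  replace (2 * C * (1 / (INR m + 1) + 1 / (INR n + 1)))
    with (0 * (k - h) + 2 * C * (1 / (INR m + 1) + 1 / (INR n + 1))) by ring.
  apply (RInt_extension_close f h k C (D n) (phi' m) (phi n) (mi_union (D' m)));
    auto.
  - apply Hadm'.
  - exact (admissible_extension_bounded f _ _ _ C Hoff' HC Hadm').
  - now apply outer_le_union_of.
  - lra.
  - intros x Hx HxD _. destruct Hadm' as (_ & Hext & _).
    rewrite Hext by now split. rewrite Rminus_diag, Rabs_R0. lra. }
assert (Hsmall : forall eps, 0 < eps -> exists N, forall m n,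
  (N <= m)%nat -> (N <= n)%nat ->
  2 * C * (1 / (INR m + 1) + 1 / (INR n + 1)) < eps).
{ intros eps Heps.
  destruct (eventually_inv_lt (eps / (4 * (C + 1)))) as (N & HN).
  { apply Rdiv_lt_0_compat; lra. }
  exists N. intros m n Hm Hn. assert (H1 := HN m Hm). assert (H2 := HN n Hn).
  assert (E : eps / (4 * (C + 1)) * (4 * (C + 1)) = eps) by (field; lra).
  assert (P1 := inv_succ_pos m). assert (P2 := inv_succ_pos n). nra. }
destruct (proj2 (ex_lim_seq_cauchy_corr (fun n => RInt (phi n) h k)))
  as (l & Hl).
{ intros eps. destruct (Hsmall eps (cond_pos eps)) as (N & HN).
  exists N. intros m n Hm Hn.
  apply Rle_lt_trans with (1 := Hclose D phi Hch m n). auto. }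
exists l. split; [exact Hf|]. split; [now exists D, phi|].
intros D' phi' Hch'. apply is_lim_seq_spec. intros eps.
assert (He : 0 < eps / 2) by (generalize (cond_pos eps); lra).
destruct (Hsmall _ He) as (N1 & HN1).
destruct (proj2 (is_lim_seq_spec _ _) Hl (mkposreal _ He)) as (N2 & HN2).
simpl in HN2.
exists (N1 + N2)%nat. intros n Hn.
assert (H1 := Hclose D' phi' Hch' n n).
assert (H2 := HN1 n n ltac:(lia) ltac:(lia)).
assert (H3 := HN2 n ltac:(lia)).
replace (RInt (phi' n) h k - l)
  with (RInt (phi' n) h k - RInt (phi n) h k + (RInt (phi n) h k - l)) by ring.
apply Rle_lt_trans with (1 := Rabs_triang _ _). lra.
Qed.

Lemma is_tonelli_int_tonelli_int (f : pfun) (h k : R) :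
  ex_tonelli_int f h k -> is_tonelli_int f h k (tonelli_int f h k).
Proof.
intros (l & Hl). now rewrite (is_tonelli_int_unique f h k l Hl).
Qed.

(** * Egorov's theorem for quasicontinuous functions *)

Lemma continuous_off_mono (f : pfun) (I : R -> Prop) (D D' : multiinterval) :
  (forall x, mi_union D x -> mi_union D' x) ->
  continuous_off f I D -> continuous_off f I D'.
Proof.
intros HDD [Hdom Hcont].
assert (Hsub : forall x, set_off I D' x -> set_off I D x).
{ intros x [Hx HxD]. split; auto. }
split; [auto|]. apply continuous_on_iff. intros x Hx eps Heps.
destruct (proj1 (continuous_on_iff _ _) Hcont x (Hsub x Hx) eps Heps)
  as (d & Hd & H).
exists d. split; [exact Hd|]. auto.
Qed.

Lemma null_set_outer_le (N : R -> Prop) : null_set N -> outer_le N 0.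
Proof. intros H eps Heps. rewrite Rplus_0_l. now apply H. Qed.

Lemma ex_common_continuous_off (fs : nat -> pfun) (I : R -> Prop) :
  (forall n, quasicontinuous (fs n) I) -> forall eps, 0 < eps ->
  exists D, Rbar_lt (mi_length D) eps /\ forall n, continuous_off (fs n) I D.
Proof.
intros Hqc eps Heps.
destruct (functional_choice (fun n D =>
  Rbar_lt (mi_length D) (eps / 2 * (/ 2) ^ S n) /\ continuous_off (fs n) I D))
  as (Ds & HDs).
{ intros n. apply Hqc. apply Rmult_lt_0_compat; [lra|]. apply pow_lt. lra. }
destruct (outer_le_countable_union (fun n => mi_union (Ds n))
  (fun n => eps / 2 * (/ 2) ^ S n) (eps / 2)) with (eps := eps / 2)
  as (D & HD & HDsD).
- intros n. apply outer_le_union_of, HDs.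
- intros N. apply sum_n_halves_le. lra.
- lra.
- exists D. split.
  + replace eps with (eps / 2 + eps / 2) by lra. exact HD.
  + intros n. apply continuous_off_mono with (Ds n); [|apply HDs].
    intros x Hx. apply HDsD. now exists n.
Qed.

(** Extend the [fs n] from the complement of a common small multiinterval [D] and
    apply [egorov_continuous].  The extensions need not converge on [D], so that
    theorem never bounds their oscillation set by less than the length of [D]:
    [D] and the extensions have to be chosen anew for each [eps]. *)
Lemma outer_le_oscillation (h k M : R) (fs : nat -> pfun)
    (f : pfun) :
  h < k -> (forall n, quasicontinuous (fs n) (segment h k)) ->
  (forall n x, segment h k x -> pdom (fs n) x -> Rabs (fs n x) <= M) ->
  ae_on (segment h k) (converges_at fs f) ->
  forall eta eps, 0 < eta -> 0 < eps -> exists n,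
    outer_le (fun x => segment h k x /\ exists m p, (n <= m)%nat /\
      (n <= p)%nat /\ eta < Rabs (fs m x - fs p x)) eps.
Proof.
intros hk fs_qc fs_bounded fs_cvg eta eps Heta Heps.
set (e := Rmin (eps / 4) (k - h)).
assert (He : 0 < e) by (apply Rmin_pos; lra).
assert (He1 : e <= eps / 4) by apply Rmin_l.
assert (He2 : e <= k - h) by apply Rmin_r.
clearbody e.
destruct (ex_common_continuous_off fs _ fs_qc e He) as (D & HD & Hoff).
destruct (functional_choice (fun n phi => (forall x, continuous phi x) /\
  (forall x, Rabs (phi x) <= M) /\
  admissible_extension (fs n) (segment h k) D phi)) as (phi & Hphi).
{ intros n. apply ex_admissible_extension; auto.
  apply Rbar_lt_le_trans with (1 := HD). exact He2. }
assert (Hext : forall n x, set_off (segment h k) D x -> phi n x = fs n x).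
{ intros n. apply Hphi. }
destruct (egorov_continuous phi h k M (e + 0) (fun x => mi_union D x \/
    (segment h k x /\ ~ converges_at fs f x))) with (eta := eta) (eps := eps / 4)
  as (n & Hn).
- lra.
- intros n. apply Hphi.
- intros n x _. apply Hphi.
- apply outer_le_union; [now apply outer_le_union_of|].
  now apply null_set_outer_le.
- intros x Hx HxA.
  assert (Hxf : converges_at fs f x) by (apply NNPP; tauto).
  exists (f x). apply is_lim_seq_ext with (fun n => fs n x); [|apply Hxf].
  intros n. symmetry. apply Hext. split; tauto.
- exact Heta.
- lra.
- exists n.
  apply outer_le_mono with
    (3 := outer_le_union _ _ _ _ (outer_le_union_of D e HD) Hn); [|lra].
  intros x (Hx & m & p & Hm & Hp & Hmp).
  destruct (classic (mi_union D x)) as [HxD|HxD]; [now left|right].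
  split; [exact Hx|]. exists m, p. rewrite !Hext by now split. auto.
Qed.

(** The oscillation sets for the tolerances [1 / (j + 1)], with bounds that sum to
    [eps / 4], are covered together with the null set where convergence fails and
    a multiinterval off which all the [fs n] are continuous.  A uniform Cauchy
    condition passes to the limit. *)
Lemma egorov_quasicontinuous (h k M : R) (fs : nat -> pfun)
    (f : pfun) :
  h < k -> (forall n, quasicontinuous (fs n) (segment h k)) ->
  (forall n x, segment h k x -> pdom (fs n) x -> Rabs (fs n x) <= M) ->
  ae_on (segment h k) (converges_at fs f) ->
  forall eps, 0 < eps -> exists D, Rbar_lt (mi_length D) eps /\
    (forall x, set_off (segment h k) D x -> converges_at fs f x) /\
    (forall n, continuous_off (fs n) (segment h k) D) /\
    (forall eta, 0 < eta -> exists n, forall m x, (n <= m)%nat ->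
       set_off (segment h k) D x -> Rabs (fs m x - f x) <= eta).
Proof.
intros hk fs_qc fs_bounded fs_cvg eps Heps.
destruct (functional_choice (fun j n =>
  outer_le (fun x => segment h k x /\ exists m p, (n <= m)%nat /\
    (n <= p)%nat /\ 1 / (INR j + 1) < Rabs (fs m x - fs p x))
    (eps / 4 * (/ 2) ^ S j))) as (n & Hn).
{ intros j. apply (outer_le_oscillation h k M fs f); auto; [apply inv_succ_pos|].
  apply Rmult_lt_0_compat; [lra|]. apply pow_lt. lra. }
destruct (ex_common_continuous_off fs _ fs_qc (eps / 4)) as (D0 & HD0 & Hoff);
  [lra|].
assert (H1 := outer_le_countable_union _ _ (eps / 4) Hn
  ltac:(intros N; apply sum_n_halves_le; lra)).
assert (H2 := outer_le_union _ _ _ _ (outer_le_union_of D0 _ HD0)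
  (null_set_outer_le _ fs_cvg)).
destruct (outer_le_union _ _ _ _ H1 H2 (eps / 4)) as (D & HD & Hcov); [lra|].
exists D.
assert (Hcvg : forall x, set_off (segment h k) D x -> converges_at fs f x).
{ intros x [Hx HxD]. apply NNPP. intros Hno. apply HxD, Hcov. tauto. }
split; [|split; [exact Hcvg|split]].
- apply Rbar_lt_le_trans with (1 := HD). simpl. lra.
- intros i. apply continuous_off_mono with D0; [|apply Hoff].
  intros x Hx. apply Hcov. tauto.
- intros eta Heta. destruct (eventually_inv_lt eta Heta) as (j & Hj).
  specialize (Hj j (le_n j)). exists (n j). intros m x Hm [Hx HxD].
  destruct (Hcvg x (conj Hx HxD)) as (_ & _ & Hlim).
  assert (Hl : is_lim_seq (fun p => Rabs (fs m x - fs p x))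
                 (Rabs (fs m x - f x))).
  { apply (is_lim_seq_abs (fun p => fs m x - fs p x) (fs m x - f x)).
    apply (is_lim_seq_minus' (fun _ => fs m x) (fun p => fs p x));
      [apply is_lim_seq_const|exact Hlim]. }
  apply (is_lim_seq_le_loc _ (fun _ => eta) _ eta) with (2 := Hl);
    [|apply is_lim_seq_const].
  exists (n j). intros p Hp. apply Rnot_lt_le. intros Hlt.
  apply HxD, Hcov. left. exists j. split; [exact Hx|].
  exists m, p. repeat split; auto. lra.
Qed.

Lemma almost_uniform_limit (h k M : R) (fs : nat -> pfun)
    (f : pfun) :
  h < k -> (forall n, quasicontinuous (fs n) (segment h k)) ->
  (forall n x, segment h k x -> pdom (fs n) x -> Rabs (fs n x) <= M) ->
  ae_on (segment h k) (converges_at fs f) ->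
  forall eps, 0 < eps -> exists D, Rbar_lt (mi_length D) eps /\
    continuous_off f (segment h k) D /\
    (forall eta, 0 < eta -> exists n, forall m x, (n <= m)%nat ->
       set_off (segment h k) D x -> Rabs (fs m x - f x) <= eta).
Proof.
intros hk fs_qc fs_bounded fs_cvg eps Heps.
destruct (egorov_quasicontinuous h k M fs f hk fs_qc fs_bounded fs_cvg eps Heps)
  as (D & HD & Hcvg & Hoff & Hunif).
exists D. split; [exact HD|]. split; [|exact Hunif].
split; [intros x Hx; now apply Hcvg|].
apply continuous_on_iff. intros x Hx e He.
destruct (Hunif (e / 4)) as (n & Hn); [lra|].
destruct (proj1 (continuous_on_iff _ _) (proj2 (Hoff n)) x Hx (e / 4))
  as (d & Hd & Hnear); [lra|].
exists d. split; [exact Hd|]. intros y Hy Hyx.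
assert (A1 := Hn n x (le_n n) Hx). assert (A2 := Hn n y (le_n n) Hy).
assert (A3 := Hnear y Hy Hyx).
apply Rabs_le_between in A1. apply Rabs_le_between in A2.
apply Rabs_def2 in A3. apply Rabs_def1; lra.
Qed.

(** * Passage to the limit *)

Lemma bounded_quasicontinuous_limit (h k M : R) (fs : nat -> pfun)
    (f : pfun) :
  h < k -> (forall n, quasicontinuous (fs n) (segment h k)) ->
  (forall n x, segment h k x -> pdom (fs n) x -> Rabs (fs n x) <= M) ->
  ae_on (segment h k) (converges_at fs f) ->
  (forall x, segment h k x -> pdom f x -> Rabs (f x) <= M) ->
  bounded_quasicontinuous f (segment h k).
Proof.
intros hk fs_qc fs_bounded fs_cvg f_bounded.
split; [split|now exists M].
- intros eps Heps. destruct (fs_cvg eps Heps) as (D & HD & Hcov).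
  exists D. split; [exact HD|]. intros x [Hx Hdom]. apply Hcov.
  split; [exact Hx|]. intros (_ & H & _). now apply Hdom.
- intros eps Heps.
  destruct (almost_uniform_limit h k M fs f hk fs_qc fs_bounded fs_cvg eps Heps)
    as (D & HD & Hoff & _).
  now exists D.
Qed.

(** One continuous function [phi], extending [f] from the complement of a small
    multiinterval of uniform convergence, approximates [f] and all the late
    [fs n] at once. *)
Lemma bounded_convergence (h k M : R) (fs : nat -> pfun)
    (f : pfun) :
  h < k -> (forall n, quasicontinuous (fs n) (segment h k)) ->
  (forall n x, segment h k x -> pdom (fs n) x -> Rabs (fs n x) <= M) ->
  ae_on (segment h k) (converges_at fs f) ->
  (forall x, segment h k x -> pdom f x -> Rabs (f x) <= M) ->
  is_lim_seq (fun n => tonelli_int (fs n) h k) (tonelli_int f h k).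
Proof.
intros hk fs_qc fs_bounded fs_cvg f_bounded.
assert (Hf := bounded_quasicontinuous_limit h k M fs f hk fs_qc fs_bounded
                fs_cvg f_bounded).
assert (Hint := is_tonelli_int_tonelli_int _ _ _
                  (ex_tonelli_int_bounded f h k hk Hf)).
assert (Hints : forall n, is_tonelli_int (fs n) h k (tonelli_int (fs n) h k)).
{ intros n. apply is_tonelli_int_tonelli_int, ex_tonelli_int_bounded;
    [exact hk|]. split; [apply fs_qc|]. exists M. apply fs_bounded. }
apply is_lim_seq_spec. intros eps. assert (Heps := cond_pos eps).
assert (HM := Rabs_pos M). assert (HM' := Rle_abs M).
(* With e as length and as tolerance, the integral of fs n is within
   e * (k - h) + 2 * M * e of that of phi, which is within 2 * M * e of that
   of f; the sum is less than e * K. *)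
set (K := (k - h) + 4 * Rabs M + 1).
assert (HK : 0 < K) by (unfold K; lra).
set (e := eps / K).
assert (He : 0 < e) by (unfold e; apply Rdiv_lt_0_compat; lra).
assert (EK : e * K = eps) by (unfold e; field; lra).
unfold K in EK. clearbody e.
destruct (almost_uniform_limit h k M fs f hk fs_qc fs_bounded fs_cvg
  (Rmin e (k - h))) as (D & HD & Hoff & Hunif); [apply Rmin_pos; lra|].
assert (HDe : Rbar_lt (mi_length D) e).
{ apply Rbar_lt_le_trans with (1 := HD). apply Rmin_l. }
assert (HDk : Rbar_lt (mi_length D) (k - h)).
{ apply Rbar_lt_le_trans with (1 := HD). apply Rmin_r. }
destruct (ex_admissible_extension f h k M D hk HDk Hoff f_bounded)
  as (phi & _ & HphiM & Hphi & Hext & _).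
assert (HA := outer_le_union_of D e HDe).
assert (H1 := tonelli_int_close f h k M _ phi (mi_union D) e 0 hk f_bounded Hint
  Hphi (fun x _ => HphiM x) HA (Rle_refl 0)
  ltac:(intros x Hx HxD _; rewrite (Hext x (conj Hx HxD)), Rminus_diag, Rabs_R0;
        apply Rle_refl)).
destruct (Hunif e He) as (N & HN). exists N. intros n Hn.
assert (H2 := tonelli_int_close (fs n) h k M _ phi (mi_union D) e e hk
  (fs_bounded n) (Hints n) Hphi (fun x _ => HphiM x) HA (Rlt_le _ _ He)
  ltac:(intros x Hx HxD _; rewrite (Hext x (conj Hx HxD)), Rabs_minus_sym;
        exact (HN n x Hn (conj Hx HxD)))).
apply Rabs_le_between in H1. apply Rabs_le_between in H2.
apply Rabs_def1; nra.
Qed.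

Theorem theorem61 (h k : R) (hk : h < k) (fs : nat -> pfun) (f : pfun) (M : R)
  (fs_qc : forall n, quasicontinuous (fs n) (segment h k))
  (fs_bounded : forall n x, segment h k x -> pdom (fs n) x ->
    Rabs (fs n x) < M)
  (fs_cvg : ae_on (segment h k) (converges_at fs f))
  (f_lim : forall x, segment h k x -> pdom f x -> converges_at fs f x) :
  bounded_quasicontinuous f (segment h k) /\
  (forall n, ex_tonelli_int (fs n) h k) /\
  ex_tonelli_int (lim_pfun fs) h k /\
  ex_tonelli_int f h k /\
  is_lim_seq (fun n => tonelli_int (fs n) h k)
    (tonelli_int (lim_pfun fs) h k) /\
  tonelli_int (lim_pfun fs) h k = tonelli_int f h k.
Proof.
assert (fs_le : forall n x, segment h k x -> pdom (fs n) x ->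
  Rabs (fs n x) <= M) by (intros; left; auto).
assert (Hle : forall g : pfun, (forall x, segment h k x -> pdom g x ->
  converges_at fs g x) -> forall x, segment h k x -> pdom g x -> Rabs (g x) <= M).
{ intros g Hg x Hx Hdom. destruct (Hg x Hx Hdom) as (Hd & _ & Hlim).
  apply (is_lim_seq_le (fun n => Rabs (fs n x)) (fun _ => M) (Rabs (g x)) M).
  - auto.
  - exact (is_lim_seq_abs _ (g x) Hlim).
  - apply is_lim_seq_const. }
assert (lim_lim : forall x, pdom (lim_pfun fs) x ->
  converges_at fs (lim_pfun fs) x).
{ intros x Hx. split; [apply Hx|]. split; [exact Hx|].
  apply Lim_seq_correct', Hx. }
assert (lim_cvg : ae_on (segment h k) (converges_at fs (lim_pfun fs))).
{ intros eps Heps. destruct (fs_cvg eps Heps) as (D & HD & Hcov).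
  exists D. split; [exact HD|]. intros x [Hx Hno]. apply Hcov.
  split; [exact Hx|]. intros (Hd & _ & Hlim). apply Hno, lim_lim.
  split; [exact Hd|]. now exists (f x). }
assert (lim_le := Hle (lim_pfun fs) (fun x _ => lim_lim x)).
assert (f_le := Hle f f_lim).
assert (f_bqc := bounded_quasicontinuous_limit h k M fs f hk fs_qc fs_le
                   fs_cvg f_le).
assert (C1 := bounded_convergence h k M fs _ hk fs_qc fs_le lim_cvg lim_le).
assert (C2 := bounded_convergence h k M fs f hk fs_qc fs_le fs_cvg f_le).
split; [exact f_bqc|]. split; [|split; [|split; [|split]]].
- intros n. apply ex_tonelli_int_bounded; [exact hk|].
  split; [apply fs_qc|]. exists M. apply fs_le.
- apply ex_tonelli_int_bounded; [exact hk|].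
  exact (bounded_quasicontinuous_limit h k M fs _ hk fs_qc fs_le lim_cvg lim_le).
- now apply ex_tonelli_int_bounded.
- exact C1.
- apply is_lim_seq_unique in C1. apply is_lim_seq_unique in C2.
  rewrite C1 in C2. now injection C2.
Qed.
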